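(* Let $\mathcal{K}$ be an $\omega$-standard model of $\mathsf{ZFC}$, and let $U$ be an element of $\mathcal{K}$ such that $\mathcal{K}\models$ ''$U$ is a nonprincipal ultrafilter over $\omega$''. Let $\mathcal{M}$ be the internal ultrapower of $\mathcal{K}$ modulo $U$, and identify $\mathcal{K}$ with its image under the elementary embedding $j:\mathcal{K}\to\mathcal{M}$, $j(k)=[\underline{k}]_U$, so that the universe $K$ of $\mathcal{K}$ is a subset of the universe $M$ of $\mathcal{M}$. Then $\mathcal{M}$ and $\mathcal{K}$ are models of $\mathsf{ZF}$ such that for every parametrically $\mathcal{M}$-definable subset $D$ of $M$, $(\mathcal{K},D\cap K)\models\mathsf{ZF}(P)$, where $P$ is a fresh unary predicate interpreted by $D\cap K$; but none of the following three conditions holds: (1) There is an $(\mathcal{M},\mathcal{K})$-definable isomorphism between $\mathcal{K}$ and $(V_\kappa,\in)^{\mathcal{M}}$ for some strongly inaccessible cardinal $\kappa$ of $\mathcal{M}$. (2) There is an $(\mathcal{M},\mathcal{K})$-definable isomorphism between $\mathcal{K}$ and $\mathcal{M}$. (3) There is an $(\mathcal{M},\mathcal{K})$-definable embedding of $\mathcal{M}$ as a proper rank initial segment of $\mathcal{K}$.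
   Context: A model of set theory is $\omega$-standard if its set of natural numbers is isomorphic to the true $\omega$ (it has no nonstandard natural numbers). The internal ultrapower of $\mathcal{K}$ modulo $U$ has as elements the classes $[f]_U$, for $f$ in $\mathcal{K}$ such that $\mathcal{K}\models$ ''$f$ is a function with domain $\omega$'', where $[f]_U=[g]_U$ iff $\mathcal{K}\models\{n\in\omega: f(n)=g(n)\}\in U$, and its membership relation is given by $[f]_U\in^{\mathcal{M}}[g]_U$ iff $\mathcal{K}\models\{n\in\omega: f(n)\in g(n)\}\in U$. For $k$ in $\mathcal{K}$, $\underline{k}$ is the constant function in $\mathcal{K}$ with domain $\omega$ and value $k$. $\mathsf{ZF}(P)$ is $\mathsf{ZF}$ with the separation and replacement (collection) schemes extended to formulae of the language $\{\in,P\}$. ''$(\mathcal{M},\mathcal{K})$-definable'' means definable, with parameters, in the structure obtained by expanding $\mathcal{M}$ with predicates for the universe $K$ and the membership relation $\in^{\mathcal{K}}$ of $\mathcal{K}$. An embedding of $\mathcal{M}$ as a proper rank initial segment of $\mathcal{K}$ is an embedding whose image $I$ is a proper subset of $K$ such that whenever $a\in I$, $b\in K$, and the rank of $b$ is at most the rank of $a$ in $\mathcal{K}$, then $b\in I$. *)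

(* Defs.v *)
From Stdlib Require Import Classical FinFun.

Set Implicit Arguments.
Unset Strict Implicit.
Unset Printing Implicit Defensive.

(** * Languages, structures, satisfaction *)

(** Structures for the language with equality, the binary symbol ∈, extra unary
    symbols [P1] and extra binary symbols [P2]. *)
Record structure (P1 P2 : Type) := Structure {
  carrier :> Type;
  mem : carrier -> carrier -> Prop;
  un : P1 -> carrier -> Prop;
  bin : P2 -> carrier -> carrier -> Prop
}.

Notation "x ∈ y" := (mem x y) (at level 70, no associativity).

Definition set_structure := structure Empty_set Empty_set.

Definition SetStructure (A : Type) (E : A -> A -> Prop) : set_structure :=
  Structure E (fun p : Empty_set => match p with end)
              (fun p : Empty_set => match p with end).

(** Variables are de Bruijn indices: [f_ex] binds variable 0. *)
Inductive form (P1 P2 : Type) :=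
| f_eq (i j : nat)
| f_mem (i j : nat)
| f_un (p : P1) (i : nat)
| f_bin (p : P2) (i j : nat)
| f_neg (phi : form P1 P2)
| f_and (phi psi : form P1 P2)
| f_ex (phi : form P1 P2).

Arguments f_eq {P1 P2} i j.
Arguments f_mem {P1 P2} i j.
Arguments f_un {P1 P2} p i.
Arguments f_bin {P1 P2} p i j.

Definition scons {A : Type} (a : A) (e : nat -> A) (n : nat) : A :=
  match n with 0 => a | S m => e m end.

Notation "a .: e" := (scons a e) (at level 55, right associativity).

Fixpoint sat {P1 P2} (S : structure P1 P2) (e : nat -> S) (phi : form P1 P2)
  : Prop :=
  match phi with
  | f_eq i j => e i = e j
  | f_mem i j => e i ∈ e j
  | f_un p i => un p (e i)
  | f_bin p i j => bin p (e i) (e j)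
  | f_neg phi => ~ sat e phi
  | f_and phi psi => sat e phi /\ sat e psi
  | f_ex phi => exists a : S, sat (a .: e) phi
  end.

(** Parameters are the values of the assignment beyond the displayed arguments. *)
Definition definable {P1 P2} (S : structure P1 P2) (D : S -> Prop) : Prop :=
  exists (phi : form P1 P2) (e : nat -> S), forall x, D x <-> sat (x .: e) phi.

Definition definable2 {P1 P2} (S : structure P1 P2) (R : S -> S -> Prop) : Prop :=
  exists (phi : form P1 P2) (e : nat -> S),
    forall x y, R x y <-> sat (x .: y .: e) phi.

Definition elementary_embedding {P1 P2} (A B : structure P1 P2) (h : A -> B) : Prop :=
  forall (phi : form P1 P2) (e : nat -> A),
    sat e phi <-> sat (fun n => h (e n)) phi.

Definition embedding (A B : set_structure) (h : A -> B) : Prop :=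
  Injective h /\ forall x y, x ∈ y <-> h x ∈ h y.

(** * Set-theoretic notions, evaluated inside a structure *)

Definition is_empty {P1 P2} {S : structure P1 P2} (z : S) := forall x, ~ x ∈ z.

Definition sub {P1 P2} {S : structure P1 P2} (a b : S) := forall x, x ∈ a -> x ∈ b.

Definition is_succ {P1 P2} {S : structure P1 P2} (s x : S) :=
  forall y, y ∈ s <-> y ∈ x \/ y = x.

Definition is_power {P1 P2} {S : structure P1 P2} (p a : S) :=
  forall x, x ∈ p <-> sub x a.

Definition is_upair {P1 P2} {S : structure P1 P2} (p a b : S) :=
  forall x, x ∈ p <-> x = a \/ x = b.

(** Kuratowski pairs: [p = {{a}, {a, b}}]. *)
Definition is_opair {P1 P2} {S : structure P1 P2} (p a b : S) :=
  exists s d, is_upair s a a /\ is_upair d a b /\ is_upair p s d.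

Definition inductive {P1 P2} {S : structure P1 P2} (v : S) :=
  (exists z, is_empty z /\ z ∈ v) /\
  (forall x, x ∈ v -> exists s, is_succ s x /\ s ∈ v).

Definition is_omega {P1 P2} {S : structure P1 P2} (w : S) :=
  inductive w /\ forall v, inductive v -> sub w v.

(** [f(x) = y] *)
Definition app {P1 P2} {S : structure P1 P2} (f x y : S) :=
  exists p, p ∈ f /\ is_opair p x y.

Definition function_on {P1 P2} {S : structure P1 P2} (f a : S) :=
  (forall p, p ∈ f -> exists x y, x ∈ a /\ is_opair p x y) /\
  (forall x, x ∈ a -> exists! y, app f x y).

Definition function_into {P1 P2} {S : structure P1 P2} (f a b : S) :=
  function_on f a /\ forall x y, app f x y -> y ∈ b.

Definition bijection {P1 P2} {S : structure P1 P2} (f a b : S) :=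
  function_into f a b /\ forall y, y ∈ b -> exists! x, app f x y.

Definition equinumerous {P1 P2} {S : structure P1 P2} (a b : S) :=
  exists f, bijection f a b.

Definition transitive_set {P1 P2} {S : structure P1 P2} (x : S) :=
  forall y, y ∈ x -> sub y x.

(** Well-foundedness of ∈ on an ordinal is supplied by Foundation. *)
Definition is_ordinal {P1 P2} {S : structure P1 P2} (x : S) :=
  transitive_set x /\
  forall y z, y ∈ x -> z ∈ x -> y ∈ z \/ y = z \/ z ∈ y.

Definition is_cardinal {P1 P2} {S : structure P1 P2} (k : S) :=
  is_ordinal k /\ forall a, a ∈ k -> ~ equinumerous a k.

Definition is_regular {P1 P2} {S : structure P1 P2} (k : S) :=
  forall a f, a ∈ k -> function_into f a k ->
    exists b, b ∈ k /\ forall x y, app f x y -> y ∈ b.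

(** [|P(a)| < k] for every [a < k]. *)
Definition is_strong_limit {P1 P2} {S : structure P1 P2} (k : S) :=
  forall a, a ∈ k -> exists p b, is_power p a /\ b ∈ k /\ equinumerous p b.

Definition strongly_inaccessible {P1 P2} {S : structure P1 P2} (k : S) :=
  is_cardinal k /\ (exists w, is_omega w /\ w ∈ k) /\
  is_regular k /\ is_strong_limit k.

(** [v = V_a], through the recursion [V_b = ⋃_{c ∈ b} P(V_c)] for [b <= a]. *)
Definition is_V {P1 P2} {S : structure P1 P2} (v a : S) :=
  exists g s, is_succ s a /\ function_on g s /\
    (forall b y, app g b y ->
       forall x, x ∈ y <-> exists c z, c ∈ b /\ app g c z /\ sub x z) /\
    app g a v.

(** The rank of [x] is the least ordinal [a] such that [x ⊆ V_a]. *)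
Definition is_rank {P1 P2} {S : structure P1 P2} (x a : S) :=
  is_ordinal a /\ (exists v, is_V v a /\ sub x v) /\
  forall b v, b ∈ a -> is_V v b -> ~ sub x v.

Definition rank_le {P1 P2} {S : structure P1 P2} (x y : S) :=
  exists a b, is_rank x a /\ is_rank y b /\ (a ∈ b \/ a = b).

Definition nonprincipal_ultrafilter {P1 P2} {S : structure P1 P2} (U w : S) :=
  (forall x, x ∈ U -> sub x w) /\
  w ∈ U /\
  (forall x, is_empty x -> ~ x ∈ U) /\
  (forall x y, x ∈ U -> sub x y -> sub y w -> y ∈ U) /\
  (forall x y z, x ∈ U -> y ∈ U ->
     (forall n, n ∈ z <-> n ∈ x /\ n ∈ y) -> z ∈ U) /\
  (forall x y, sub x w -> (forall n, n ∈ y <-> n ∈ w /\ ~ n ∈ x) ->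
     x ∈ U \/ y ∈ U) /\
  ~ (exists n, n ∈ w /\ forall x, x ∈ U <-> sub x w /\ n ∈ x).

(** * The axioms *)

(** The schemes range over the full language of the structure, so that [ZF]
    is ZF on a [set_structure] and ZF(P) on an expansion by a predicate P. *)
Record ZF {P1 P2} (S : structure P1 P2) : Prop := {
  ZF_extensionality : forall a b : S, (forall x, x ∈ a <-> x ∈ b) -> a = b;
  ZF_foundation : forall a : S, (exists x, x ∈ a) ->
    exists x, x ∈ a /\ forall y, y ∈ x -> ~ y ∈ a;
  ZF_pairing : forall a b : S, exists p, is_upair p a b;
  ZF_union : forall a : S, exists u, forall x, x ∈ u <-> exists y, y ∈ a /\ x ∈ y;
  ZF_power : forall a : S, exists p, is_power p a;
  ZF_infinity : exists v : S, inductive v;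
  ZF_separation : forall (phi : form P1 P2) (e : nat -> S) (a : S),
    exists b, forall x, x ∈ b <-> x ∈ a /\ sat (x .: e) phi;
  ZF_replacement : forall (phi : form P1 P2) (e : nat -> S) (a : S),
    (forall x y z, x ∈ a ->
       sat (x .: y .: e) phi -> sat (x .: z .: e) phi -> y = z) ->
    exists b, forall y, y ∈ b <-> exists x, x ∈ a /\ sat (x .: y .: e) phi;
  ZF_collection : forall (phi : form P1 P2) (e : nat -> S) (a : S),
    (forall x, x ∈ a -> exists y, sat (x .: y .: e) phi) ->
    exists b, forall x, x ∈ a -> exists y, y ∈ b /\ sat (x .: y .: e) phi
}.

(** Every family of nonempty pairwise disjoint sets has a transversal. *)
Definition AC {P1 P2} (S : structure P1 P2) : Prop :=
  forall a : S,
    (forall x, x ∈ a -> exists y, y ∈ x) ->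
    (forall x y z, x ∈ a -> y ∈ a -> z ∈ x -> z ∈ y -> x = y) ->
    exists c, forall x, x ∈ a -> exists! y, y ∈ x /\ y ∈ c.

Definition ZFC {P1 P2} (S : structure P1 P2) : Prop := ZF S /\ AC S.

Definition omega_standard {P1 P2} (S : structure P1 P2) : Prop :=
  exists w : S, is_omega w /\
  exists h : nat -> S, Injective h /\
    (forall x, x ∈ w <-> exists n, x = h n) /\
    (forall m n, m < n <-> h m ∈ h n).

(** * The internal ultrapower *)

(** [{n ∈ w : f(n) = g(n)} ∈ U] *)
Definition eq_mod {K : set_structure} (w U f g : K) : Prop :=
  exists s, s ∈ U /\
    forall n, n ∈ s <-> n ∈ w /\ exists y, app f n y /\ app g n y.

(** [{n ∈ w : f(n) ∈ g(n)} ∈ U] *)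
Definition mem_mod {K : set_structure} (w U f g : K) : Prop :=
  exists s, s ∈ U /\
    forall n, n ∈ s <-> n ∈ w /\ exists y z, app f n y /\ app g n z /\ y ∈ z.

(** The class [[f]_U], as a predicate on [K]. *)
Definition class {K : set_structure} (w U f : K) : K -> Prop :=
  fun g => function_on g w /\ eq_mod w U f g.

Definition ultrapower_carrier {K : set_structure} (w U : K) : Type :=
  {c : K -> Prop | exists f, function_on f w /\ forall g, c g <-> class w U f g}.

Definition ultrapower {K : set_structure} (w U : K) : set_structure :=
  SetStructure (fun c d : ultrapower_carrier w U =>
    exists f g, proj1_sig c f /\ proj1_sig d g /\ mem_mod w U f g).

Definition constant_function {K : set_structure} (w k c : K) : Prop :=
  function_on c w /\ forall n, n ∈ w -> app c n k.

Definition f_upair {P1 P2} (p a b : nat) : form P1 P2 :=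
  f_and (f_mem a p) (f_and (f_mem b p)
    (f_neg (f_ex (f_and (f_mem 0 (S p))
       (f_and (f_neg (f_eq 0 (S a))) (f_neg (f_eq 0 (S b)))))))).

Lemma sat_f_upair {P1 P2} (S : structure P1 P2) (e : nat -> S) p a b :
  sat e (f_upair p a b) <-> is_upair (e p) (e a) (e b).
Proof.
unfold is_upair; simpl; split.
- intros [Ha [Hb H]] x; split.
  + intros Hx; apply NNPP; intros N; apply H; exists x; tauto.
  + intros [-> | ->]; assumption.
- intros H; split; [apply H; auto | split; [apply H; auto |]].
  intros [x [Hx [Na Nb]]]; apply H in Hx; tauto.
Qed.

Definition f_opair {P1 P2} (p a b : nat) : form P1 P2 :=
  f_ex (f_ex (f_and (f_upair 1 (S (S a)) (S (S a)))
    (f_and (f_upair 0 (S (S a)) (S (S b))) (f_upair (S (S p)) 1 0)))).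

Lemma sat_f_opair {P1 P2} (S : structure P1 P2) (e : nat -> S) p a b :
  sat e (f_opair p a b) <-> is_opair (e p) (e a) (e b).
Proof.
unfold f_opair, is_opair.
cbn [sat]; setoid_rewrite sat_f_upair; reflexivity.
Qed.

Lemma upair_unique {P1 P2} (S : structure P1 P2) (HS : ZF S) (p q a b : S) :
  is_upair p a b -> is_upair q a b -> p = q.
Proof.
intros Hp Hq; apply (ZF_extensionality HS); intros x; rewrite (Hp x), (Hq x); tauto.
Qed.

Lemma opair_exists {P1 P2} (S : structure P1 P2) (HS : ZF S) (a b : S) :
  exists p, is_opair p a b.
Proof.
destruct (ZF_pairing HS a a) as [s Hs], (ZF_pairing HS a b) as [d Hd].
destruct (ZF_pairing HS s d) as [p Hp]; exists p, s, d; auto.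
Qed.

Lemma opair_unique {P1 P2} (S : structure P1 P2) (HS : ZF S) (p q a b : S) :
  is_opair p a b -> is_opair q a b -> p = q.
Proof.
intros [s [d [Hs [Hd Hp]]]] [s' [d' [Hs' [Hd' Hq]]]].
assert (s = s') as <- by exact (upair_unique HS Hs Hs').
assert (d = d') as <- by exact (upair_unique HS Hd Hd').
exact (upair_unique HS Hp Hq).
Qed.

Lemma upair_inj {P1 P2} (S : structure P1 P2) (p a b c d : S) :
  is_upair p a b -> is_upair p c d -> (a = c /\ b = d) \/ (a = d /\ b = c).
Proof.
intros H H'.
assert (Ha : a = c \/ a = d) by (apply H', H; auto).
assert (Hb : b = c \/ b = d) by (apply H', H; auto).
assert (Hc : c = a \/ c = b) by (apply H, H'; auto).
assert (Hd : d = a \/ d = b) by (apply H, H'; auto).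
intuition congruence.
Qed.

Lemma opair_inj {P1 P2} (S : structure P1 P2) (p a b c d : S) :
  is_opair p a b -> is_opair p c d -> a = c /\ b = d.
Proof.
intros [s [t [Hs [Ht Hp]]]] [s' [t' [Hs' [Ht' Hp']]]].
destruct (upair_inj Hp Hp') as [[<- <-] | [<- <-]].
- pose proof (upair_inj Hs Hs'); pose proof (upair_inj Ht Ht'); intuition congruence.
- pose proof (upair_inj Hs Ht'); pose proof (upair_inj Ht Hs'); intuition congruence.
Qed.

Lemma constant_function_exists {K : set_structure} (HK : ZF K) (w k : K) :
  exists c, constant_function w k c.
Proof.
destruct (@ZF_replacement _ _ _ HK (f_opair 1 0 2) (fun _ => k) w) as [c Hc].
{ intros x y z _ Hy Hz; apply sat_f_opair in Hy, Hz; exact (opair_unique HK Hy Hz). }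
assert (Hc' : forall p, p ∈ c <-> exists x, x ∈ w /\ is_opair p x k).
{ intros p; rewrite Hc; setoid_rewrite sat_f_opair; reflexivity. }
clear Hc.
assert (Happ : forall n, n ∈ w -> app c n k).
{ intros n Hn; destruct (opair_exists HK n k) as [p Hp].
  exists p; split; [apply Hc'; exists n |]; auto. }
exists c; split; [split |]; auto.
- intros p Hp; apply Hc' in Hp; destruct Hp as [x [Hx Hp]]; exists x, k; auto.
- intros x Hx; exists k; split; auto.
  intros y [p [Hp Hy]]; apply Hc' in Hp; destruct Hp as [x' [_ Hp]].
  exact (proj2 (opair_inj Hp Hy)).
Qed.

Lemma constant_function_unique {K : set_structure} (HK : ZF K) (w k c d : K) :
  constant_function w k c -> constant_function w k d -> c = d.
Proof.
assert (H : forall c d, constant_function w k c -> constant_function w k d -> sub c d).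
{ intros c' d' [[H1 H2] H3] [_ H4] p Hp.
  destruct (H1 p Hp) as [x [y [Hx Hxy]]].
  destruct (H2 x Hx) as [z [_ Hz]].
  assert (z = y) as <- by (apply Hz; exists p; auto).
  rewrite (Hz k (H3 x Hx)) in Hxy.
  destruct (H4 x Hx) as [q [Hq Hxq]].
  rewrite (opair_unique HK Hxy Hxq); exact Hq. }
intros Hc Hd; apply (ZF_extensionality HK); intros x; split; apply H; auto.
Qed.

(** The class of the constant function with value [k], as a predicate on [K]. *)
Definition constant_class {K : set_structure} (w U k : K) : K -> Prop :=
  fun g => exists c, constant_function w k c /\ class w U c g.

Lemma constant_class_spec {K : set_structure} (HK : ZF K) (w U k : K) :
  exists f, function_on f w /\
    forall g, constant_class w U k g <-> class w U f g.
Proof.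
destruct (constant_function_exists HK w k) as [c Hc].
exists c; split; [exact (proj1 Hc) |]; intros g; split.
- intros [d [Hd Hg]]; rewrite (constant_function_unique HK Hc Hd); exact Hg.
- intros Hg; exists c; auto.
Qed.

(** [j(k)] is the class of the constant function with value [k]. *)
Definition const_embedding {K : set_structure} (HK : ZF K) (w U k : K)
  : ultrapower w U :=
  exist _ (constant_class w U k) (constant_class_spec HK w U k).

(** * Expansions *)

(** [(K, P)] *)
Definition expand {K : set_structure} (P : K -> Prop) : structure unit Empty_set :=
  @Structure unit Empty_set K (@mem _ _ K) (fun _ => P)
    (fun p : Empty_set => match p with end).

(** [M] expanded with the universe and the membership relation of [K], where
    [K] is identified with its image under [j : K -> M]. *)
Definition expand_pair {M K : set_structure} (j : K -> M) : structure unit unit :=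
  @Structure unit unit M (@mem _ _ M)
    (fun _ x => exists k, x = j k)
    (fun _ x y => exists a b, x = j a /\ y = j b /\ a ∈ b).

(** The three conditions below speak of maps between [K] and [M] whose graph,
    as a binary relation on [M] (with [K] identified with its image under [j]),
    is definable with parameters in [expand_pair j]. *)

Definition iso_with_V_inaccessible {M K : set_structure} (j : K -> M) : Prop :=
  exists kappa v : M, strongly_inaccessible kappa /\ is_V v kappa /\
  exists h : K -> M, embedding h /\ (forall y, y ∈ v <-> exists x, y = h x) /\
    @definable2 _ _ (expand_pair j) (fun a b => exists x, a = j x /\ b = h x).

Definition iso_with_M {M K : set_structure} (j : K -> M) : Prop :=
  exists h : K -> M, embedding h /\ (forall y, exists x, y = h x) /\
    @definable2 _ _ (expand_pair j) (fun a b => exists x, a = j x /\ b = h x).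

Definition embeds_as_proper_rank_initial_segment {M K : set_structure}
    (j : K -> M) : Prop :=
  exists h : M -> K, embedding h /\
    (exists b, forall x, b <> h x) /\
    (forall a b, (exists x, a = h x) -> rank_le b a -> exists x, b = h x) /\
    @definable2 _ _ (expand_pair j) (fun a b => b = j (h a)).

(* Main.v *)
(** Łoś's theorem (this is where choice in [K] is needed) makes [j] elementary and
    turns every property of [M] into the largeness, modulo [U], of a set definable in
    [K]; hence the trace on [K] of an [M]-definable set is [K]-definable, and ZF holds
    in its expansion.  On the other hand the class of the identity function is a
    nonstandard integer of [M], while all integers of [K] are standard.  An embedding
    with transitive range preserves and reflects "being omega" and the standard
    integers; the range is transitive in all three cases, in the third because a member
    of a set has at most its rank. *)

Require Import Defs.
From Stdlib Require Import Classical ClassicalEpsilon FunctionalExtensionality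
  PropExtensionality ProofIrrelevance Arith Lia.

Set Implicit Arguments.
Unset Strict Implicit.
Unset Printing Implicit Defensive.

(** * Definability *)

(** Every appeal to separation, replacement or Łoś's theorem needs a formula. Compound formulas are
    not written out: [dfn] says that a predicate on assignments is given by some formula, it is
    closed under connectives, quantifiers and substitution, and a tactic derives it from the shape
    of the predicate. Two kinds of definability occur: with parameters in one structure, for the
    schemes, and uniform over all structures, for transfer. [rank_le] asserts that both ranks exist,
    so the third case forces recursion, the hierarchy V and transitive closures to be developed
    inside [K]. Seen from outside, [K] may be ill-founded, hence induction in it is restricted to
    definable predicates. Its integers, however, are reached by induction over [nat]: an embedding
    of [K] with transitive range agrees with [j] on them, and an embedding of the ultrapower with
    transitive range inverts [j] on them, which leaves no place for the nonstandard integer. *)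

Fixpoint rename {P1 P2} (f : nat -> nat) (phi : form P1 P2) : form P1 P2 :=
  match phi with
  | f_eq i j => f_eq (f i) (f j)
  | f_mem i j => f_mem (f i) (f j)
  | f_un p i => f_un p (f i)
  | f_bin p i j => f_bin p (f i) (f j)
  | f_neg phi => f_neg (rename f phi)
  | f_and phi psi => f_and (rename f phi) (rename f psi)
  | f_ex phi => f_ex (rename (0 .: fun n => S (f n)) phi)
  end.

Lemma sat_rename {P1 P2} (S : structure P1 P2) (phi : form P1 P2) f (e : nat -> S) :
  sat e (rename f phi) <-> sat (fun n => e (f n)) phi.
Proof.
revert f e; induction phi; intros f e; cbn [rename sat]; try reflexivity.
- rewrite IHphi; reflexivity.
- rewrite IHphi1, IHphi2; reflexivity.
- assert (H : forall a, sat (a .: e) (rename (0 .: fun n => Datatypes.S (f n)) phi)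
    <-> sat (a .: fun n => e (f n)) phi).
  { intros a; rewrite IHphi.
    replace (fun n => (a .: e) ((0 .: fun n => Datatypes.S (f n)) n))
      with (a .: fun n => e (f n)); [reflexivity |].
    apply functional_extensionality; intros [|n]; reflexivity. }
  setoid_rewrite H; reflexivity.
Qed.

Section Definability.
Context {I C : Type} {F : I -> set_structure} (cst : forall i, C -> F i).

Definition lookup (v : nat -> nat + C) (i : I) (e : nat -> F i) (n : nat) : F i :=
  match v n with inl k => e k | inr c => cst i c end.

(** Uniform definability over the family [F], with the constants [cst] as
    parameters: [C = Empty_set] gives one parameter-free formula for all of [F],
    and [C = F i] for a single structure [F i] allows arbitrary parameters. *)
Definition dfn (R : forall i, (nat -> F i) -> Prop) : Prop :=
  exists phi v, forall i e, R i e <-> sat (lookup v e) phi.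

(** The language has no function symbols, so a term is a coordinate of the assignment or a constant.
    Equality of functions lets unification find the index. *)
Definition dterm (t : forall i, (nat -> F i) -> F i) : Prop :=
  (exists k, t = fun i e => e k) \/ (exists c, t = fun i e => cst i c).

Definition code (t : forall i, (nat -> F i) -> F i) (s : nat + C) : Prop :=
  forall i e, t i e = match s with inl k => e k | inr c => cst i c end.

Lemma dterm_code t : dterm t -> exists s, code t s.
Proof.
intros [[k ->] | [c ->]]; [exists (inl k) | exists (inr c)]; intros i e; reflexivity.
Qed.

Lemma dfn_sat (phi : form Empty_set Empty_set) (t : nat -> forall i, (nat -> F i) -> F i) :
  (forall n, dterm (t n)) -> dfn (fun i e => sat (fun n => t n i e) phi).
Proof.
intros Ht.
destruct (choice (fun n s => code (t n) s) (fun n => dterm_code (Ht n))) as [v Hv].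
exists phi, v; intros i e.
replace (lookup v e) with (fun n => t n i e); [reflexivity |].
apply functional_extensionality; intros n; apply (Hv n).
Qed.

Lemma dfn_iff (R R' : forall i, (nat -> F i) -> Prop) :
  (forall i e, R i e <-> R' i e) -> dfn R' -> dfn R.
Proof.
intros H [phi [v Hv]]; exists phi, v; intros i e; rewrite H; apply Hv.
Qed.

Lemma dfn_mem t u : dterm t -> dterm u -> dfn (fun i e => t i e ∈ u i e).
Proof.
intros Ht Hu.
apply (dfn_sat (f_mem 0 1) (t := fun n => match n with 0 => t | _ => u end)).
intros [|n]; assumption.
Qed.

Lemma dfn_eq t u : dterm t -> dterm u -> dfn (fun i e => t i e = u i e).
Proof.
intros Ht Hu.
apply (dfn_sat (f_eq 0 1) (t := fun n => match n with 0 => t | _ => u end)).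
intros [|n]; assumption.
Qed.

Lemma dfn_not R : dfn R -> dfn (fun i e => ~ R i e).
Proof.
intros [phi [v Hv]]; exists (f_neg phi), v; intros i e; cbn; rewrite Hv; reflexivity.
Qed.

Lemma dfn_and R R' : dfn R -> dfn R' -> dfn (fun i e => R i e /\ R' i e).
Proof.
intros [phi [v Hv]] [psi [v' Hv']].
(* The two formulas come with different lookups; interleaving their variables on even and odd
   indices lets one lookup serve both. *)
exists (f_and (rename (fun n => 2 * n) phi) (rename (fun n => 2 * n + 1) psi)).
exists (fun n => if Nat.even n then v (Nat.div2 n) else v' (Nat.div2 n)).
intros i e; cbn [sat]; rewrite !sat_rename, Hv, Hv'.
match goal with |- sat ?a _ /\ sat ?b _ <-> sat ?c _ /\ sat ?d _ =>
  replace c with a; [replace d with b; [reflexivity |] |] end;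
  apply functional_extensionality; intros n; unfold lookup.
- rewrite Nat.even_odd, Nat.add_1_r, Nat.div2_succ_double; reflexivity.
- rewrite Nat.even_even, Nat.div2_double; reflexivity.
Qed.

Lemma dfn_ex (R : forall i, (nat -> F i) -> F i -> Prop) :
  dfn (fun i e => R i (fun n => e (S n)) (e 0)) -> dfn (fun i e => exists x, R i e x).
Proof.
intros [phi [v Hv]].
(* Several formula variables may be looked up at coordinate 0; all of them become the bound
   variable. Any other variable [n] keeps its own slot, [S n] under the quantifier. The value
   [pred 0] is never read. *)
exists (f_ex (rename (fun n => match v n with inl 0 => 0 | _ => S n end) phi)).
exists (fun n => match v n with inl k => inl (pred k) | inr c => inr c end).
intros i e; cbn [sat].
assert (E : forall x, R i e x <-> sat (lookup v (x .: e)) phi)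
  by (intros x; apply (Hv i (x .: e))).
setoid_rewrite E; setoid_rewrite sat_rename.
assert (E' : forall x, lookup v (x .: e) = fun n => (x .: lookup
  (fun n => match v n with inl k => inl (pred k) | inr c => inr c end) e)
  match v n with inl 0 => 0 | _ => S n end).
{ intros x; apply functional_extensionality; intros n.
  unfold lookup; destruct (v n) as [[|k]|c] eqn:H; cbn; rewrite ?H; reflexivity. }
split; intros [x Hx]; exists x; [rewrite <- E' | rewrite E']; exact Hx.
Qed.

Lemma dfn_or R R' : dfn R -> dfn R' -> dfn (fun i e => R i e \/ R' i e).
Proof.
intros H H'; apply dfn_iff with (R' := fun i e => ~ (~ R i e /\ ~ R' i e)).
- intros i e; tauto.
- apply dfn_not, dfn_and; apply dfn_not; assumption.
Qed.

Lemma dfn_imp R R' : dfn R -> dfn R' -> dfn (fun i e => R i e -> R' i e).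
Proof.
intros H H'; apply dfn_iff with (R' := fun i e => ~ (R i e /\ ~ R' i e)).
- intros i e; tauto.
- apply dfn_not, dfn_and; [| apply dfn_not]; assumption.
Qed.

Lemma dfn_equiv R R' : dfn R -> dfn R' -> dfn (fun i e => R i e <-> R' i e).
Proof. intros H H'; apply dfn_and; apply dfn_imp; assumption. Qed.

Lemma dfn_all (R : forall i, (nat -> F i) -> F i -> Prop) :
  dfn (fun i e => R i (fun n => e (S n)) (e 0)) -> dfn (fun i e => forall x, R i e x).
Proof.
intros H; apply dfn_iff with (R' := fun i e => ~ exists x, ~ R i e x).
- intros i e; split; [intros H' [x N]; auto |].
  intros N x; apply NNPP; intros N'; apply N; exists x; exact N'.
- apply dfn_not, (dfn_ex (R := fun i e x => ~ R i e x)), dfn_not, H.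
Qed.

Lemma dfn_subst R (t : nat -> forall i, (nat -> F i) -> F i) :
  dfn R -> (forall n, dterm (t n)) -> dfn (fun i e => R i (fun n => t n i e)).
Proof.
intros [phi [v Hv]] Ht.
apply dfn_iff with (R' := fun i e => sat (fun n =>
  match v n with inl k => t k | inr c => fun i _ => cst i c end i e) phi).
- intros i e; rewrite Hv; unfold lookup.
  match goal with |- sat ?a _ <-> sat ?b _ => replace b with a; [reflexivity |] end.
  apply functional_extensionality; intros n; destruct (v n); reflexivity.
- apply dfn_sat; intros n; destruct (v n) as [k | c]; [apply Ht |].
  right; exists c; reflexivity.
Qed.

End Definability.

Arguments dfn {I C F} cst R.
Arguments dterm {I C F} cst t.

Definition pdf {K : set_structure} (R : (nat -> K) -> Prop) : Prop :=
  dfn (F := fun _ : unit => K) (fun _ (c : K) => c) (fun _ e => R e).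

Definition def1 {K : set_structure} (Q : K -> Prop) : Prop := pdf (fun e => Q (e 0)).

Definition def2 {K : set_structure} (R : K -> K -> Prop) : Prop :=
  pdf (fun e => R (e 0) (e 1)).

(** One parameter-free formula serves every structure, so its truth can be moved from [K] to the
    ultrapower. *)
Definition udf (R : forall S : set_structure, (nat -> S) -> Prop) : Prop :=
  dfn (fun (S : set_structure) (c : Empty_set) => match c return S with end) R.

Lemma dfn_def1 {K : set_structure} (Q : K -> Prop) t : def1 Q ->
  dterm (F := fun _ : unit => K) (fun _ (c : K) => c) t ->
  dfn (F := fun _ : unit => K) (fun _ (c : K) => c) (fun i e => Q (t i e)).
Proof. intros H Ht; exact (dfn_subst (t := fun _ => t) H (fun _ => Ht)). Qed.

Lemma dfn_def2 {K : set_structure} (R : K -> K -> Prop) t u : def2 R ->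
  dterm (F := fun _ : unit => K) (fun _ (c : K) => c) t ->
  dterm (F := fun _ : unit => K) (fun _ (c : K) => c) u ->
  dfn (F := fun _ : unit => K) (fun _ (c : K) => c) (fun i e => R (t i e) (u i e)).
Proof.
intros H Ht Hu.
apply (dfn_subst (t := fun n => match n with 0 => t | _ => u end) H).
intros [|n]; assumption.
Qed.

Ltac dterm := first [left; eexists; reflexivity | right; eexists; reflexivity].

Ltac dfn_unfold := progress unfold is_V, is_empty, is_succ, function_into, function_on,
  app, is_opair, is_upair, is_power, inductive, is_omega, transitive_set, is_ordinal, sub, unique.

(** Hypotheses [def1] and [def2] in the context act as additional atomic formulas. *)
Ltac dfn_step :=
  cbv beta;
  lazymatch goal with
  | |- dfn _ (fun i e => @?A i e <-> @?B i e) => apply (dfn_equiv (R := A) (R' := B))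
  | |- dfn _ (fun i e => @?A i e /\ @?B i e) => apply (dfn_and (R := A) (R' := B))
  | |- dfn _ (fun i e => @?A i e \/ @?B i e) => apply (dfn_or (R := A) (R' := B))
  | |- dfn _ (fun i e => ~ @?A i e) => apply (dfn_not (R := A))
  | |- dfn _ (fun i e => exists x, @?A i e x) => apply (dfn_ex (R := A))
  | |- dfn _ (fun i e => @?t i e ∈ @?u i e) => apply (dfn_mem (t := t) (u := u)); dterm
  | |- dfn _ (fun i e => @eq _ (@?t i e) (@?u i e)) =>
      apply (dfn_eq (t := t) (u := u)); dterm
  | H : def1 ?Q |- dfn _ (fun i e => ?Q (@?t i e)) => apply (dfn_def1 (t := t) H); dterm
  | H : def2 ?R |- dfn _ (fun i e => ?R (@?t i e) (@?u i e)) =>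
      apply (dfn_def2 (t := t) (u := u) H); dterm
  | |- dfn _ _ => first [dfn_unfold | apply dfn_imp | apply dfn_all]
  end.

Ltac dfn := lazymatch goal with
  | |- def1 _ => unfold def1, pdf | |- def2 _ => unfold def2, pdf | |- pdf _ => unfold pdf
  | |- udf _ => unfold udf end; repeat dfn_step.

Lemma def2_sat {K : set_structure} (R : K -> K -> Prop) (d : K) : def2 R ->
  exists phi e, forall x y, R x y <-> sat (x .: y .: e) phi.
Proof.
intros [phi [v Hv]].
(* [R] depends on coordinates 0 and 1 alone, so all coordinates past 0 may be read as [y]. Constants
   move to the parameter slots from 2 on, and [d] fills the slots that are not read. *)
exists (rename (fun n => match v n with
  inl 0 => 0 | inl (S _) => 1 | inr _ => S (S n) end) phi).
exists (fun n => match v n with inl _ => d | inr c => c end).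
intros x y; rewrite sat_rename.
specialize (Hv tt (x .: fun _ => y)); cbn in Hv; rewrite Hv.
match goal with |- sat ?a _ <-> sat ?b _ => replace b with a; [reflexivity |] end.
apply functional_extensionality; intros n.
unfold lookup; destruct (v n) as [[|k]|c] eqn:E; cbn; rewrite ?E; reflexivity.
Qed.

(** * Set theory in a model of ZF *)

(** Omega without the quantifier over all inductive sets, hence absolute between
    structures related by an embedding with transitive range. *)
Definition omega_like {S : set_structure} (v : S) : Prop :=
  inductive v /\ forall x, x ∈ v -> is_empty x \/ exists y, y ∈ v /\ is_succ x y.

Section SetTheory.
Context {K : set_structure} (HK : ZF K).
Implicit Types (a b c f g s t u w x y z : K).

Lemma set_ext a b : (forall x, x ∈ a <-> x ∈ b) -> a = b.
Proof. apply (ZF_extensionality HK). Qed.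

Lemma separation (Q : K -> Prop) a : def1 Q ->
  exists b, forall x, x ∈ b <-> x ∈ a /\ Q x.
Proof.
intros HQ.
assert (H : def2 (fun x _ => Q x)) by dfn.
destruct (def2_sat a H) as [phi [e He]].
destruct (ZF_separation HK phi (a .: e) a) as [b Hb]; exists b; intros x.
rewrite Hb, <- He; reflexivity.
Qed.

Lemma replacement (R : K -> K -> Prop) a : def2 R ->
  (forall x y z, x ∈ a -> R x y -> R x z -> y = z) ->
  exists b, forall y, y ∈ b <-> exists x, x ∈ a /\ R x y.
Proof.
intros HR Hf; destruct (def2_sat a HR) as [phi [e He]].
destruct (ZF_replacement HK (phi := phi) (e := e) (a := a)) as [b Hb].
- intros x y z; rewrite <- !He; apply Hf.
- exists b; intros y; rewrite Hb; setoid_rewrite He; reflexivity.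
Qed.

Lemma collection (R : K -> K -> Prop) a : def2 R ->
  (forall x, x ∈ a -> exists y, R x y) ->
  exists b, forall x, x ∈ a -> exists y, y ∈ b /\ R x y.
Proof.
intros HR Ht; destruct (def2_sat a HR) as [phi [e He]].
destruct (ZF_collection HK (phi := phi) (e := e) (a := a)) as [b Hb].
- intros x Hx; destruct (Ht x Hx) as [y Hy]; exists y; apply He, Hy.
- exists b; intros x Hx; destruct (Hb x Hx) as [y Hy]; exists y; rewrite He; exact Hy.
Qed.

Lemma union_replacement (R : K -> K -> Prop) a : def2 R ->
  (forall x y z, x ∈ a -> R x y -> R x z -> y = z) ->
  exists b, forall t, t ∈ b <-> exists x y, x ∈ a /\ R x y /\ t ∈ y.
Proof.
intros HR Hf; destruct (replacement HR Hf) as [c Hc].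
destruct (ZF_union HK c) as [b Hb]; exists b; intros t; rewrite Hb; split.
- intros [y [Hy Ht]]; apply Hc in Hy; destruct Hy as [x [Hx Hy]]; exists x, y; auto.
- intros [x [y [Hx [Hy Ht]]]]; exists y; split; [apply Hc; exists x |]; auto.
Qed.

Lemma least_element (Q : K -> Prop) s a : def1 Q -> a ∈ s -> Q a ->
  exists b, b ∈ s /\ Q b /\ forall c, c ∈ b -> c ∈ s -> ~ Q c.
Proof.
intros HQ Ha Qa; destruct (separation s HQ) as [d Hd].
destruct (ZF_foundation HK (a := d)) as [b [Hb Hmin]].
- exists a; apply Hd; auto.
- apply Hd in Hb; exists b; repeat split; try apply Hb.
  intros c Hc Hs Qc; apply (Hmin c Hc), Hd; auto.
Qed.

Lemma transitive_induction (Q : K -> Prop) s : def1 Q -> transitive_set s ->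
  (forall x, x ∈ s -> (forall y, y ∈ x -> Q y) -> Q x) -> forall x, x ∈ s -> Q x.
Proof.
intros HQ Hs IH x Hx; apply NNPP; intros N.
assert (HQ' : def1 (fun x => ~ Q x)) by dfn.
destruct (least_element HQ' Hx N) as [b [Hb [Nb Hmin]]].
apply Nb, IH; auto.
intros y Hy; apply NNPP, Hmin; auto; apply (Hs b); auto.
Qed.

Lemma empty_exists a : exists z : K, is_empty z.
Proof.
assert (H : def1 (fun x => ~ x = x)) by dfn.
destruct (separation a H) as [z Hz]; exists z; intros x Hx; apply Hz in Hx; tauto.
Qed.

Lemma empty_unique y z : is_empty y -> is_empty z -> y = z.
Proof.
intros Hy Hz; apply set_ext; intros x; split; intros H; [elim (Hy x) | elim (Hz x)]; auto.
Qed.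

Lemma union2_exists a b : exists u, forall x, x ∈ u <-> x ∈ a \/ x ∈ b.
Proof.
destruct (ZF_pairing HK a b) as [p Hp], (ZF_union HK p) as [u Hu].
exists u; intros x; rewrite Hu; split.
- intros [y [Hy Hx]]; apply Hp in Hy; destruct Hy as [-> | ->]; auto.
- intros [H | H]; [exists a | exists b]; split; auto; apply Hp; auto.
Qed.

Lemma succ_exists x : exists s, is_succ s x.
Proof.
destruct (ZF_pairing HK x x) as [p Hp], (union2_exists x p) as [s Hs].
exists s; intros y; rewrite Hs, (Hp y); tauto.
Qed.

Lemma succ_unique s t x : is_succ s x -> is_succ t x -> s = t.
Proof. intros Hs Ht; apply set_ext; intros y; rewrite (Hs y), (Ht y); reflexivity. Qed.

Lemma mem_irrefl x : ~ x ∈ x.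
Proof.
intros Hx; destruct (ZF_pairing HK x x) as [p Hp].
destruct (ZF_foundation HK (a := p)) as [y [Hy Hmin]]; [exists x; apply Hp; auto |].
assert (y = x) as -> by (apply Hp in Hy; tauto); apply (Hmin x); auto.
Qed.

Lemma app_dom f a x y : function_on f a -> app f x y -> x ∈ a.
Proof.
intros [Hf _] [p [Hp Hxy]]; destruct (Hf p Hp) as [x' [y' [Hx' Hp']]].
destruct (opair_inj Hxy Hp') as [-> _]; exact Hx'.
Qed.

Lemma app_fun f a x y z : function_on f a -> app f x y -> app f x z -> y = z.
Proof.
intros Hf Hy Hz; destruct (proj2 Hf x (app_dom Hf Hy)) as [y' [_ Hu]].
rewrite <- (Hu y Hy); apply Hu, Hz.
Qed.

Lemma app_total f a x : function_on f a -> x ∈ a -> exists y, app f x y.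
Proof. intros [_ Hf] Hx; destruct (Hf x Hx) as [y [Hy _]]; exists y; exact Hy. Qed.

Lemma function_exists (R : K -> K -> Prop) s : def2 R ->
  (forall b, b ∈ s -> exists! y, R b y) ->
  exists g, function_on g s /\ forall b y, app g b y <-> b ∈ s /\ R b y.
Proof.
intros HR Hf.
assert (D : def2 (fun x p => exists y, R x y /\ is_opair p x y)) by dfn.
destruct (replacement D (a := s)) as [g Hg].
{ intros x p q Hx [y [Hy Hp]] [z [Hz Hq]].
  destruct (Hf x Hx) as [y' [_ Hu]].
  rewrite <- (Hu y Hy), <- (Hu z Hz) in *; exact (opair_unique HK Hp Hq). }
assert (Happ : forall b y, app g b y <-> b ∈ s /\ R b y).
{ intros b y; split.
  - intros [p [Hp Hby]]; apply Hg in Hp; destruct Hp as [x [Hx [z [Hz Hp]]]].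
    destruct (opair_inj Hby Hp) as [-> ->]; auto.
  - intros [Hb Hy]; destruct (opair_exists HK b y) as [p Hp].
    exists p; split; [apply Hg; exists b; split; [| exists y] |]; auto. }
exists g; split; [split |]; auto.
- intros p Hp; apply Hg in Hp; destruct Hp as [x [Hx [y [Hy Hp]]]]; exists x, y; auto.
- intros x Hx; destruct (Hf x Hx) as [y [Hy Hu]].
  exists y; split; [apply Happ; auto |].
  intros z Hz; apply Hu, Happ, Hz.
Qed.

Lemma omega_exists : exists w : K, is_omega w.
Proof.
destruct (ZF_infinity HK) as [v Hv].
assert (D : def1 (fun x => forall v, inductive v -> x ∈ v)) by dfn.
destruct (separation v D) as [w Hw]; exists w; split; [split |].
- destruct (empty_exists v) as [z Hz]; exists z; split; auto.
  assert (H : forall v : K, inductive v -> z ∈ v).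
  { intros v' [[z' [Hz' H]] _]; rewrite (empty_unique Hz Hz'); exact H. }
  apply Hw; auto.
- intros y Hy; apply Hw in Hy; destruct Hy as [Hy Hall].
  destruct (succ_exists y) as [s Hs]; exists s; split; auto.
  assert (H : forall v : K, inductive v -> s ∈ v).
  { intros v' Hv'; destruct (proj2 Hv' y (Hall v' Hv')) as [s' [Hs' H]].
    rewrite (succ_unique Hs Hs'); exact H. }
  apply Hw; auto.
- intros v' Hv' y Hy; apply Hw in Hy; apply Hy, Hv'.
Qed.

Lemma omega_mem_empty w z : is_omega w -> is_empty z -> z ∈ w.
Proof.
intros [[[z' [Hz' H]] _] _] Hz; rewrite (empty_unique Hz Hz'); exact H.
Qed.

Lemma omega_mem_succ w s x : is_omega w -> x ∈ w -> is_succ s x -> s ∈ w.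
Proof.
intros [[_ Hi] _] Hx Hs; destruct (Hi x Hx) as [s' [Hs' H]].
rewrite (succ_unique Hs Hs'); exact H.
Qed.

Lemma omega_induction w (Q : K -> Prop) : is_omega w -> def1 Q ->
  (forall z, is_empty z -> Q z) ->
  (forall x s, x ∈ w -> Q x -> is_succ s x -> Q s) -> forall x, x ∈ w -> Q x.
Proof.
intros Hw HQ H0 HS x Hx; destruct (separation w HQ) as [v Hv].
apply (Hv x), Hw; auto; split.
- destruct (empty_exists w) as [z Hz]; exists z; split; auto.
  apply Hv; split; [apply omega_mem_empty |]; auto.
- intros y Hy; apply Hv in Hy; destruct Hy as [Hy Qy].
  destruct (succ_exists y) as [s Hs]; exists s; split; auto.
  apply Hv; split; [apply omega_mem_succ with y | apply HS with y]; auto.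
Qed.

Lemma omega_transitive w : is_omega w -> transitive_set w.
Proof.
intros Hw.
assert (D : def1 (fun x => sub x w)) by dfn.
refine (omega_induction Hw D _ _).
- intros z Hz y Hy; elim (Hz y Hy).
- intros x s Hx IH Hs y Hy; apply Hs in Hy; destruct Hy as [Hy | ->]; auto.
Qed.

Lemma succ_transitive s x : transitive_set x -> is_succ s x -> transitive_set s.
Proof.
intros Hx Hs y Hy z Hz; apply Hs; left; apply Hs in Hy; destruct Hy as [Hy | ->]; auto.
apply (Hx y); auto.
Qed.

Lemma omega_elements_transitive w : is_omega w -> forall x, x ∈ w -> transitive_set x.
Proof.
intros Hw.
assert (D : def1 (@transitive_set _ _ K)) by dfn.
refine (omega_induction Hw D _ _).
- intros z Hz y Hy; elim (Hz y Hy).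
- intros y s _ IH Hs; apply succ_transitive with y; auto.
Qed.

Lemma omega_is_omega_like w : is_omega w -> omega_like w.
Proof.
intros Hw; split; [apply Hw |].
assert (D : def1 (fun x => is_empty x \/ exists y, y ∈ w /\ is_succ x y)) by dfn.
refine (omega_induction Hw D _ _); [tauto |].
intros x s Hx _ Hs; right; exists x; auto.
Qed.

(** A minimal element of [v] outside omega would be empty or the successor of an element of
    omega. *)
Lemma omega_like_unique v w : omega_like v -> is_omega w -> v = w.
Proof.
intros [Hi Hv] Hw; apply set_ext; intros x; split; [| apply Hw, Hi].
intros Hx; apply NNPP; intros N.
assert (D : def1 (fun x => ~ x ∈ w)) by dfn.
destruct (least_element D Hx N) as [b [Hb [Nb Hmin]]].
destruct (Hv b Hb) as [H0 | [y [Hy Hs]]].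
- apply Nb, omega_mem_empty; auto.
- apply Nb, omega_mem_succ with y; auto.
  apply NNPP, Hmin; auto; apply Hs; auto.
Qed.

End SetTheory.

(** * Recursion *)

Section Recursion.
Context {K : set_structure} (HK : ZF K).
Implicit Types (a b c f g s t u v w x y z : K).

(* [φ t z] means [t ∈ G(z)] for an operation [G]; the value at [b] is
   [F(b) = x0 ∪ ⋃_{c ∈ b} G(F(c))].  The choice [G = P], [x0 = ∅] gives [V_b], and
   [G = ⋃], [x0 = {x}] along ω gives the transitive closure of [{x}]. *)
Context (φ : K -> K -> Prop) (Dφ : def2 φ)
  (Hφ : forall z, exists A : K, forall t, t ∈ A <-> φ t z) (x0 : K).

Definition step (val : K -> K -> Prop) b y : Prop :=
  forall t, t ∈ y <-> t ∈ x0 \/ exists c z, c ∈ b /\ val c z /\ φ t z.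

(** The usual approximations to a recursion: set functions obeying it on a transitive domain.
    Transitivity makes any two of them agree where both are defined. *)
Definition rec_value v a : Prop := exists g s, transitive_set s /\ a ∈ s /\
  function_on g s /\ (forall b y, app g b y -> step (app g) b y) /\ app g a v.

Lemma rec_value_def : def2 rec_value.
Proof. unfold rec_value, step; dfn. Qed.

Lemma rec_value_unique v v' a : rec_value v a -> rec_value v' a -> v = v'.
Proof.
intros [g [s [Ts [Ha [Hg [Rg Hv]]]]]] [g' [s' [Ts' [Ha' [Hg' [Rg' Hv']]]]]].
assert (D : def1 (fun b => forall y y', app g b y -> app g' b y' -> y = y')) by dfn.
clear Ha'; revert v v' Hv Hv'; revert a Ha.
refine (transitive_induction HK D Ts _); intros b Hb IH y y' Hy Hy'.
pose proof (Rg _ _ Hy) as E; pose proof (Rg' _ _ Hy') as E'.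
pose proof (app_dom Hg' Hy') as Hb'.
apply (set_ext HK); intros t; rewrite (E t), (E' t).
apply or_iff_compat_l; split; intros [c [z [Hc [Hz Ht]]]].
- destruct (app_total Hg' (Ts' _ Hb' _ Hc)) as [z' Hz'].
  rewrite (IH c Hc z z' Hz Hz') in Ht; exists c, z'; auto.
- destruct (app_total Hg (Ts _ Hb _ Hc)) as [z' Hz'].
  rewrite <- (IH c Hc z' z Hz' Hz) in Ht; exists c, z'; auto.
Qed.

Lemma rec_value_step v a : rec_value v a -> step (fun c z => rec_value z c) a v.
Proof.
intros [g [s [Ts [Ha [Hg [Rg Hv]]]]]] t; rewrite (Rg _ _ Hv t).
assert (H : forall c, c ∈ a -> forall z, app g c z -> rec_value z c).
{ intros c Hc z Hz; exists g, s.
  exact (conj Ts (conj (Ts a Ha c Hc) (conj Hg (conj Rg Hz)))). }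
apply or_iff_compat_l; split; intros [c [z [Hc [Hz Ht]]]].
- exists c, z; auto.
- destruct (app_total Hg (Ts _ Ha _ Hc)) as [z' Hz'].
  rewrite (rec_value_unique Hz (H c Hc z' Hz')) in Ht; exists c, z'; auto.
Qed.

Lemma step_exists b : (forall c, c ∈ b -> exists z, rec_value z c) ->
  exists! y, step (fun c z => rec_value z c) b y.
Proof.
intros Hb; pose proof rec_value_def as D.
(* Here [A] is the set [G(F(c))]; replacement and union collect these sets over [c ∈ b]. *)
assert (D' : def2 (fun c A => exists z, rec_value z c /\ forall t, t ∈ A <-> φ t z)) by dfn.
destruct (union_replacement HK D' (a := b)) as [B HB].
{ intros c A A' _ [z [Hz HA]] [z' [Hz' HA']]; apply (set_ext HK); intros t.
  rewrite HA, HA', (rec_value_unique Hz Hz'); reflexivity. }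
destruct (union2_exists HK x0 B) as [y Hy].
exists y; split.
- intros t; rewrite Hy, HB; apply or_iff_compat_l; split.
  + intros [c [A [Hc [[z [Hz HA]] Ht]]]]; exists c, z; rewrite <- HA; auto.
  + intros [c [z [Hc [Hz Ht]]]]; destruct (Hφ z) as [A HA].
    exists c, A; rewrite HA; repeat split; eauto.
- intros y' Hy'; apply (set_ext HK); intros t; rewrite (Hy' t), Hy, HB.
  apply or_iff_compat_l; split.
  + intros [c [A [Hc [[z [Hz HA]] Ht]]]]; exists c, z; rewrite <- HA; auto.
  + intros [c [z [Hc [Hz Ht]]]]; destruct (Hφ z) as [A HA].
    exists c, A; rewrite HA; repeat split; eauto.
Qed.

(** Once the elements of [b] have values, an approximation is built on [b ∪ {b}], which is
    transitive because [b] is. The assumptions on [T] cover both omega and the ordinals. *)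
Lemma rec_value_exists T : transitive_set T -> (forall b, b ∈ T -> transitive_set b) ->
  forall b, b ∈ T -> exists v, rec_value v b.
Proof.
intros HT Hel; pose proof rec_value_def as D.
assert (D' : def1 (fun b => exists v, rec_value v b)) by dfn.
refine (transitive_induction HK D' HT _); intros b Hb IH.
destruct (succ_exists HK b) as [s Hs].
pose proof (succ_transitive (Hel b Hb) Hs) as Ts.
(* The graph is given by one step from known values, because a value at [b] itself is not yet
   available; below [b] this agrees with [rec_value], by [Hgc]. *)
assert (Ds : def2 (fun d y => step (fun c z => rec_value z c) d y))
  by (unfold step; dfn).
assert (Hsub : forall d c, d ∈ s -> c ∈ d -> c ∈ b).
{ intros d c Hd Hc; apply Hs in Hd; destruct Hd as [Hd | ->]; auto.
  apply (Hel b Hb d); auto. }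
destruct (function_exists HK Ds (s := s)) as [g [Hg Happ]].
{ intros d Hd; apply step_exists; intros c Hc; apply IH, (Hsub d); auto. }
assert (Hgc : forall c, c ∈ b -> forall z, app g c z <-> rec_value z c).
{ intros c Hc z; rewrite Happ; split.
  - intros [_ Hz]; destruct (IH c Hc) as [z' Hz'].
    assert (z = z') as ->; [| exact Hz'].
    apply (set_ext HK); intros t; rewrite (Hz t), (rec_value_step Hz' t); reflexivity.
  - intros Hz; split; [apply Hs; auto | apply rec_value_step, Hz]. }
destruct (app_total Hg (proj2 (Hs b) (or_intror eq_refl))) as [v Hv].
exists v, g, s; split; [exact Ts | split; [apply Hs; auto |]].
split; [exact Hg | split; [| exact Hv]].
intros d y Hy t; apply Happ in Hy; destruct Hy as [Hd E]; rewrite (E t).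
apply or_iff_compat_l; split; intros [c [z [Hc [Hz Ht]]]]; exists c, z;
  [rewrite (Hgc c (Hsub _ _ Hd Hc)) | rewrite (Hgc c (Hsub _ _ Hd Hc)) in Hz]; auto.
Qed.

End Recursion.

(** * Transitive closures, ordinals, the hierarchy V and ranks *)

Section Ranks.
Context {K : set_structure} (HK : ZF K).
Implicit Types (a b c f g s t u v w x y z : K).

(** Stage 0 is [{x}], and an element of an element of stage [n] lies in stage [n + 1], so the union
    of the stages over omega is transitive. *)
Lemma transitive_closure_exists x : exists T, x ∈ T /\ transitive_set T.
Proof.
destruct (omega_exists HK) as [w Hw].
destruct (ZF_pairing HK x x) as [x0 Hx0].
set (φ := fun t z : K => exists y, y ∈ z /\ t ∈ y).
assert (Dφ : def2 φ) by (unfold φ; dfn).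
assert (Hφ : forall z, exists A : K, forall t, t ∈ A <-> φ t z).
{ intros z; destruct (ZF_union HK z) as [A HA]; exists A; exact HA. }
pose proof (rec_value_exists HK Dφ Hφ x0 (omega_transitive HK Hw)
  (omega_elements_transitive HK Hw)) as Hex.
pose proof (rec_value_def Dφ x0) as D.
assert (D' : def2 (fun n v => rec_value φ x0 v n)).
{ set (R := rec_value φ x0) in *; dfn. }
destruct (union_replacement HK D' (a := w)) as [T HT].
{ intros n v1 v2 _; apply (rec_value_unique HK). }
exists T; split.
- destruct (empty_exists HK w) as [z Hz].
  pose proof (omega_mem_empty HK Hw Hz) as Hzw.
  destruct (Hex z Hzw) as [v0 Hv0].
  apply HT; exists z, v0; repeat split; auto.
  apply (rec_value_step HK Hv0); left; apply Hx0; auto.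
- intros y Hy t Ht; apply HT in Hy; destruct Hy as [n [vn [Hn [Hvn Hy]]]].
  destruct (succ_exists HK n) as [s Hs].
  pose proof (omega_mem_succ HK Hw Hn Hs) as Hsw.
  destruct (Hex s Hsw) as [vs Hvs].
  apply HT; exists s, vs; repeat split; auto.
  apply (rec_value_step HK Hvs); right; exists n, vn.
  repeat split; auto; [apply Hs; auto | exists y; auto].
Qed.

(** If [z ∈ y ∈ b] but not [z ∈ b], then comparability in [a] gives [z = b] or [b ∈ z], and
    [{b, y, z}] has no minimal element. *)
Lemma ordinal_mem a b : is_ordinal a -> b ∈ a -> is_ordinal b.
Proof.
intros [Ta La] Hb; split; [| intros y z Hy Hz; apply La; apply (Ta b); auto].
intros y Hy z Hz.
pose proof (Ta b Hb y Hy) as Hya; pose proof (Ta y Hya z Hz) as Hza.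
assert (D : def1 (fun t => t = b \/ t = y \/ t = z)) by dfn.
destruct (La z b Hza Hb) as [H | H]; [exact H | exfalso].
destruct (least_element HK D Hb (or_introl eq_refl)) as [m [Hm [[-> | [-> | ->]] Hmin]]].
- apply (Hmin y); auto.
- apply (Hmin z); auto.
- destruct H as [-> | H]; [apply (Hmin y) | apply (Hmin b)]; auto.
Qed.

(** A minimal element of [b] outside [a] is [a] itself. *)
Lemma ordinal_sub a b : is_ordinal a -> is_ordinal b -> sub a b -> a = b \/ a ∈ b.
Proof.
intros [Ta La] [Tb Lb] Hab.
destruct (classic (exists x, x ∈ b /\ ~ x ∈ a)) as [[x [Hx Nx]] | N].
- right.
  assert (D : def1 (fun t => ~ t ∈ a)) by dfn.
  destruct (least_element HK D Hx Nx) as [m [Hm [Nm Hmin]]].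
  assert (a = m) as ->; [| exact Hm].
  apply (set_ext HK); intros t; split; intros Ht.
  + destruct (Lb t m (Hab t Ht) Hm) as [H | [-> | H]]; [exact H | tauto |].
    elim Nm; apply (Ta t); auto.
  + apply NNPP, Hmin; auto; apply (Tb m); auto.
- left; apply (set_ext HK); intros t; split; [apply Hab |].
  intros Ht; apply NNPP; intros Nt; apply N; exists t; auto.
Qed.

(** The intersection [c] is an ordinal included in both; if it differed from both, it would belong
    to both and hence to itself. *)
Lemma ordinal_trichotomy a b : is_ordinal a -> is_ordinal b -> a ∈ b \/ a = b \/ b ∈ a.
Proof.
intros Ha Hb.
assert (D : def1 (fun t => t ∈ b)) by dfn.
destruct (separation HK a D) as [c Hc].
assert (Oc : is_ordinal c).
{ split.
  - intros y Hy z Hz; apply Hc in Hy; destruct Hy as [Hya Hyb]; apply Hc.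
    split; [apply (proj1 Ha y) | apply (proj1 Hb y)]; auto.
  - intros y z Hy Hz; apply Hc in Hy, Hz; apply Ha; tauto. }
destruct (ordinal_sub Oc Ha) as [E | Hca]; [intros t Ht; apply Hc, Ht | |];
destruct (ordinal_sub Oc Hb) as [E' | Hcb]; try (intros t Ht; apply Hc, Ht).
- right; left; congruence.
- left; congruence.
- right; right; congruence.
- elim (mem_irrefl HK (x := c)); apply Hc; auto.
Qed.

Lemma succ_ordinal s a : is_ordinal a -> is_succ s a -> is_ordinal s.
Proof.
intros [Ta La] Hs; split; [apply succ_transitive with a; auto |].
intros y z Hy Hz; apply Hs in Hy, Hz.
destruct Hy as [Hy | ->], Hz as [Hz | ->]; auto.
Qed.

Lemma union_ordinal A u : (forall a, a ∈ A -> is_ordinal a) ->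
  (forall x, x ∈ u <-> exists y, y ∈ A /\ x ∈ y) -> is_ordinal u.
Proof.
intros HA Hu; split.
- intros y Hy z Hz; apply Hu in Hy; destruct Hy as [a [Ha Hy]].
  apply Hu; exists a; split; auto; apply (proj1 (HA a Ha) y); auto.
- intros y z Hy Hz; apply Hu in Hy, Hz.
  destruct Hy as [a [Ha Hy]], Hz as [b [Hb Hz]].
  apply ordinal_trichotomy; [apply ordinal_mem with a | apply ordinal_mem with b]; auto.
Qed.

Lemma sub_def : def2 (@sub _ _ K).
Proof. dfn. Qed.

(** [is_V] prescribes the domain [a ∪ {a}], whereas [rec_value] allows any transitive domain; in the
    backward direction the function is rebuilt on the prescribed domain. *)
Lemma is_V_rec_value z0 v a : is_empty z0 -> is_ordinal a ->
  is_V v a <-> rec_value (@sub _ _ K) z0 v a.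
Proof.
intros Hz0 Ha; pose proof sub_def as D; split.
- intros [g [s [Hs [Hg [Rg Hv]]]]]; exists g, s; repeat split; auto; try apply Hg.
  + apply succ_transitive with a; [apply Ha | exact Hs].
  + apply Hs; auto.
  + intros Ht; right; apply (Rg _ _ H), Ht.
  + intros [Ht | Ht]; [elim (Hz0 t Ht) | apply (Rg _ _ H), Ht].
- intros Hv; destruct (succ_exists HK a) as [s Hs].
  pose proof (succ_ordinal Ha Hs) as Os.
  pose proof (rec_value_exists HK D (ZF_power HK) z0 (proj1 Os)
    (fun b Hb => proj1 (ordinal_mem Os Hb))) as Hex.
  pose proof (rec_value_def D z0) as DR.
  assert (DR' : def2 (fun b y => rec_value (@sub _ _ K) z0 y b)).
  { set (R := rec_value _ z0) in *; dfn. }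
  destruct (function_exists HK DR' (s := s)) as [g [Hg Happ]].
  { intros b Hb; destruct (Hex b Hb) as [y Hy]; exists y; split; auto.
    intros y' Hy'; exact (rec_value_unique HK Hy Hy'). }
  exists g, s; repeat split; try apply Hs; try apply Hg; auto.
  + intros Hx; apply Happ in H; destruct H as [Hb Hy].
    apply (rec_value_step HK Hy) in Hx; destruct Hx as [Hx | [c [z [Hc [Hz Hx]]]]].
    * elim (Hz0 _ Hx).
    * exists c, z; repeat split; auto; apply Happ; split; auto.
      apply (proj1 Os b); auto.
  + intros [c [z [Hc [Hz Hx]]]]; apply Happ in H, Hz.
    apply (rec_value_step HK (proj2 H)); right; exists c, z; tauto.
  + apply Happ; split; [apply Hs |]; auto.
Qed.

Lemma V_exists a : is_ordinal a -> exists v, is_V v a.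
Proof.
intros Ha; destruct (empty_exists HK a) as [z0 Hz0], (succ_exists HK a) as [s Hs].
pose proof (succ_ordinal Ha Hs) as Os.
destruct (rec_value_exists HK sub_def (ZF_power HK) z0 (proj1 Os)
    (fun b Hb => proj1 (ordinal_mem Os Hb)) (b := a)) as [v Hv].
- apply Hs; auto.
- exists v; apply (is_V_rec_value v Hz0 Ha), Hv.
Qed.

Lemma mem_V v a x : is_ordinal a -> is_V v a ->
  x ∈ v <-> exists c z, c ∈ a /\ is_V z c /\ sub x z.
Proof.
intros Ha Hv; destruct (empty_exists HK a) as [z0 Hz0].
apply (is_V_rec_value v Hz0 Ha) in Hv; rewrite (rec_value_step HK Hv x).
split.
- intros [Hx | [c [z [Hc [Hz Hx]]]]]; [elim (Hz0 x Hx) |].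
  exists c, z; repeat split; auto.
  apply (is_V_rec_value z Hz0 (ordinal_mem Ha Hc)), Hz.
- intros [c [z [Hc [Hz Hx]]]]; right; exists c, z; repeat split; auto.
  apply (is_V_rec_value z Hz0 (ordinal_mem Ha Hc)), Hz.
Qed.

Lemma V_transitive v a : is_ordinal a -> is_V v a -> transitive_set v.
Proof.
intros Ha Hv x Hx y Hy.
apply (mem_V x Ha Hv) in Hx; destruct Hx as [c [z [Hc [Hz Hx]]]].
apply Hx, (mem_V y (ordinal_mem Ha Hc) Hz) in Hy; destruct Hy as [d [u [Hd [Hu Hy]]]].
apply (mem_V y Ha Hv); exists d, u; repeat split; auto.
apply (proj1 Ha c); auto.
Qed.

(** For [c ∈ b], induction gives [c ⊆ V_c], hence [c ∈ V_b]. This later puts omega into [V_κ]. *)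
Lemma ordinal_sub_V v a : is_ordinal a -> is_V v a -> sub a v.
Proof.
intros Ha Hv; destruct (succ_exists HK a) as [s Hs].
pose proof (succ_ordinal Ha Hs) as Os.
assert (D : def1 (fun b => forall v, is_V v b -> sub b v)) by dfn.
assert (Has : a ∈ s) by (apply Hs; auto).
clear Ha Hs; revert v Hv; revert a Has.
refine (transitive_induction HK D (proj1 Os) _); intros b Hb IH v Hv c Hc.
pose proof (ordinal_mem Os Hb) as Ob; pose proof (ordinal_mem Ob Hc) as Oc.
destruct (V_exists Oc) as [z Hz].
apply (mem_V c Ob Hv); exists c, z; repeat split; auto.
Qed.

(** Induction runs inside a transitive set containing [x]. Collection yields ordinals for the
    elements of [y], possibly mixed with other sets, which separation removes; the successor of the
    union of these ordinals lies above them all. *)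
Lemma sub_V_exists x : exists a v, is_ordinal a /\ is_V v a /\ sub x v.
Proof.
destruct (transitive_closure_exists x) as [T [HxT HT]].
assert (D : def1 (fun x => exists a v, is_ordinal a /\ is_V v a /\ sub x v)) by dfn.
revert x HxT; refine (transitive_induction HK D HT _); intros y _ IH.
assert (D' : def2 (fun z a => is_ordinal a /\ exists v, is_V v a /\ sub z v)) by dfn.
destruct (collection HK D' (a := y)) as [B HB].
{ intros z Hz; destruct (IH z Hz) as [a [v [Ha Hv]]]; exists a; split; eauto. }
assert (DO : def1 (@is_ordinal _ _ K)) by dfn.
destruct (separation HK B DO) as [A HA], (ZF_union HK A) as [u Hu].
assert (Ou : is_ordinal u) by (apply union_ordinal with A; auto; intros a Ha; apply HA, Ha).
destruct (succ_exists HK u) as [s Hs].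
pose proof (succ_ordinal Ou Hs) as Os; destruct (V_exists Os) as [v Hv].
exists s, v; repeat split; try apply Os; auto.
intros z Hz; destruct (HB z Hz) as [a [HaB [Oa [va [Hva Hzva]]]]].
apply (mem_V z Os Hv); exists a, va; repeat split; auto.
apply Hs; destruct (ordinal_sub Oa Ou) as [-> | H]; auto.
intros t Ht; apply Hu; exists a; split; auto; apply HA; auto.
Qed.

Lemma rank_exists x : exists a, is_rank x a.
Proof.
destruct (sub_V_exists x) as [a [v [Ha [Hv Hx]]]], (succ_exists HK a) as [s Hs].
assert (D : def1 (fun c => exists v, is_V v c /\ sub x v)) by dfn.
assert (Has : a ∈ s) by (apply Hs; auto).
destruct (least_element HK D Has) as [b [Hb [Eb Hmin]]]; [eauto |].
pose proof (succ_ordinal Ha Hs) as Os.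
exists b; repeat split; try apply (ordinal_mem Os Hb); auto.
intros c vc Hc Hvc Hxc; apply (Hmin c Hc); eauto; apply (proj1 Os b); auto.
Qed.

(** From [x ∈ y ⊆ V_a] follows [x ⊆ V_c] for some [c ∈ a]; the least such [c] is the rank of [x]. *)
Lemma mem_rank_le x y : x ∈ y -> rank_le x y.
Proof.
intros Hxy; destruct (rank_exists y) as [a [Ha [[v [Hv Hy]] Hmin]]].
pose proof (Hy x Hxy) as Hx; apply (mem_V x Ha Hv) in Hx.
destruct Hx as [c [z [Hc [Hz Hx]]]].
assert (D : def1 (fun c => exists v, is_V v c /\ sub x v)) by dfn.
destruct (least_element HK D Hc) as [b [Hb [Eb Hbmin]]]; [eauto |].
exists b, a; repeat split; auto; try apply Ha; try apply (ordinal_mem Ha Hb); eauto.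
intros d vd Hd Hvd Hxd; apply (Hbmin d Hd); eauto; apply (proj1 Ha b); auto.
Qed.

End Ranks.

(** * Satisfaction as a definable relation *)

(** The values [t i e] come from functions with definable graph and are not terms, so atomic
    formulas name them by quantified variables. The induction is on a fixed formula, so no internal
    truth predicate arises. *)
Lemma pdf_sat {K : set_structure} (phi : form Empty_set Empty_set)
    (t : nat -> (nat -> K) -> K) :
  (forall i, pdf (fun e => e 0 = t i (fun n => e (S n)))) ->
  pdf (fun e => sat (fun i => t i e) phi).
Proof.
revert t; induction phi; intros t Ht; cbn [sat]; try contradiction.
- apply dfn_iff with (R' := fun _ e => exists y, y = t i e /\ y = t j e).
  { intros _ e; split; [intros H; exists (t i e); auto | intros [y [<- H]]; exact H]. }
  apply (dfn_ex (F := fun _ : unit => K) (R := fun _ e y => y = t i e /\ y = t j e)).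
  apply (dfn_and (R := fun _ e => e 0 = t i (fun n => e (S n)))
    (R' := fun _ e => e 0 = t j (fun n => e (S n)))); apply Ht.
- apply dfn_iff with (R' := fun _ e => exists y z, y = t i e /\ z = t j e /\ y ∈ z).
  { intros _ e; split; [intros H; exists (t i e), (t j e); auto |].
    intros [y [z [-> [-> H]]]]; exact H. }
  (* Under both quantifiers [y] is at 1, [z] at 0 and the old assignment starts at 2; each of the
     two substitutions skips the slot of the other value. *)
  pose proof (dfn_subst (t := fun n => match n with 0 => fun _ e => e 1
    | S n => fun _ e => e (S (S n)) end) (Ht i)) as Hi.
  pose proof (dfn_subst (t := fun n => match n with 0 => fun _ e => e 0
    | S n => fun _ e => e (S (S n)) end) (Ht j)) as Hj.
  apply (dfn_ex (F := fun _ : unit => K)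
    (R := fun _ e y => exists z, y = t i e /\ z = t j e /\ y ∈ z)).
  apply (dfn_ex (F := fun _ : unit => K) (R := fun _ e z =>
    e 0 = t i (fun n => e (S n)) /\ z = t j (fun n => e (S n)) /\ e 0 ∈ z)).
  apply (dfn_and (R := fun _ e => e 1 = t i (fun n => e (S (S n))))
    (R' := fun _ e => e 0 = t j (fun n => e (S (S n))) /\ e 1 ∈ e 0)); [|
  apply (dfn_and (R := fun _ e => e 0 = t j (fun n => e (S (S n))))
    (R' := fun _ e => e 1 ∈ e 0)); [| repeat dfn_step]].
  + apply Hi; intros [|n]; dterm.
  + apply Hj; intros [|n]; dterm.
- apply (dfn_not (R := fun _ e => sat (fun i => t i e) phi)), IHphi, Ht.
- apply (dfn_and (R := fun _ e => sat (fun i => t i e) phi1)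
    (R' := fun _ e => sat (fun i => t i e) phi2)); [apply IHphi1 | apply IHphi2]; exact Ht.
- apply (dfn_ex (F := fun _ : unit => K)
    (R := fun _ e a => sat (a .: fun i => t i e) phi)).
  set (t' := fun i e => match i with 0 => e 0 | S i => t i (fun n => e (S n)) end : K).
  apply dfn_iff with (R' := fun _ e => sat (fun i => t' i e) phi).
  { intros _ e; replace (fun i => t' i e) with (e 0 .: fun i => t i (fun n => e (S n)));
      [reflexivity |].
    apply functional_extensionality; intros [|i]; reflexivity. }
  apply IHphi; intros [|i]; unfold t'; [dfn |].
  apply (dfn_subst (t := fun n => match n with 0 => fun _ e => e 0
    | S n => fun _ e => e (S (S n)) end) (Ht i)).
  intros [|n]; dterm.
Qed.

(** * Expansions by a definable predicate *)

Section Expansion.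
Context {K : set_structure} (P : K -> Prop) (DP : def1 P).

Lemma expand_sat_pdf (phi : form unit Empty_set) :
  pdf (fun e : nat -> K => sat (S := expand P) e phi).
Proof.
induction phi; cbn [sat]; try contradiction.
- apply (dfn_eq (t := fun _ e => e i) (u := fun _ e => e j)); dterm.
- apply (dfn_mem (F := fun _ : unit => K) (t := fun _ e => e i) (u := fun _ e => e j)); dterm.
- apply (dfn_def1 (t := fun _ e => e i) DP); dterm.
- apply (dfn_not (R := fun _ e => sat (S := expand P) e phi)), IHphi.
- apply (dfn_and (R := fun _ e => sat (S := expand P) e phi1)
    (R' := fun _ e => sat (S := expand P) e phi2)); assumption.
- apply (dfn_ex (F := fun _ : unit => K)
    (R := fun _ e a => sat (S := expand P) (a .: e) phi)).
  refine (dfn_iff _ IHphi); intros i e.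
  replace (e 0 .: fun n => e (S n)) with e; [reflexivity |].
  apply functional_extensionality; intros [|n]; reflexivity.
Qed.

Lemma expand_sat_def1 (phi : form unit Empty_set) (e : nat -> K) :
  def1 (fun x => sat (S := expand P) (x .: e) phi).
Proof.
pose proof (dfn_subst (t := fun n => match n with 0 => fun _ e => e 0
    | S n => fun _ _ => e n end) (expand_sat_pdf phi)) as H.
refine (dfn_iff _ (H _)).
- intros i e'; cbv beta.
  match goal with |- sat ?a _ <-> sat ?b _ => replace b with a; [reflexivity |] end.
  apply functional_extensionality; intros [|n]; reflexivity.
- intros [|n]; dterm.
Qed.

Lemma expand_sat_def2 (phi : form unit Empty_set) (e : nat -> K) :
  def2 (fun x y => sat (S := expand P) (x .: y .: e) phi).
Proof.
pose proof (dfn_subst (t := fun n => match n with 0 => fun _ e => e 0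
    | 1 => fun _ e => e 1 | S (S n) => fun _ _ => e n end) (expand_sat_pdf phi)) as H.
refine (dfn_iff _ (H _)).
- intros i e'; cbv beta.
  match goal with |- sat ?a _ <-> sat ?b _ => replace b with a; [reflexivity |] end.
  apply functional_extensionality; intros [|[|n]]; reflexivity.
- intros [|[|n]]; dterm.
Qed.

(** Replacing [P] by its definition turns each instance of a scheme for the expansion into an
    instance for [K]. *)
Lemma ZF_expand : ZF K -> ZF (expand P).
Proof.
intros HK; split.
- apply (ZF_extensionality HK).
- apply (ZF_foundation HK).
- apply (ZF_pairing HK).
- apply (ZF_union HK).
- apply (ZF_power HK).
- apply (ZF_infinity HK).
- intros phi e a; exact (separation HK a (expand_sat_def1 phi e)).
- intros phi e a; apply (replacement HK (expand_sat_def2 phi e)).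
- intros phi e a; apply (collection HK (expand_sat_def2 phi e)).
Qed.

End Expansion.

(** * The internal ultrapower *)

Section Ultrapower.
Context {K : set_structure} (HK : ZFC K) (w U : K)
  (HU : nonprincipal_ultrafilter U w).
Let HZ : ZF K := proj1 HK.
Implicit Types (f g s t x y z n : K).

(* Outside the domain of [f] the value is the junk value [n]. *)
Definition val f n : K :=
  match excluded_middle_informative (exists y, app f n y) with
  | left H => proj1_sig (constructive_indefinite_description _ H)
  | right _ => n
  end.

Lemma val_app f n : function_on f w -> n ∈ w -> app f n (val f n).
Proof.
intros Hf Hn; unfold val; destruct (excluded_middle_informative _) as [H | H].
- exact (proj2_sig (constructive_indefinite_description _ H)).
- elim H; exact (app_total Hf Hn).
Qed.

Lemma val_eq f n y : function_on f w -> app f n y -> val f n = y.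
Proof.
intros Hf Hy; apply (app_fun (x := n) Hf); [apply val_app | exact Hy]; auto.
exact (app_dom Hf Hy).
Qed.

(** The junk value [n] keeps the graph of [val f] expressible by a formula with parameter [f]. *)
Lemma val_graph f n y : function_on f w ->
  y = val f n <-> app f n y \/ (~ exists z, app f n z) /\ y = n.
Proof.
intros Hf; split.
- intros ->; unfold val; destruct (excluded_middle_informative _) as [H | H].
  + left; exact (proj2_sig (constructive_indefinite_description _ H)).
  + right; auto.
- intros [Hy | [N ->]]; [symmetry; apply val_eq; auto |].
  unfold val; destruct (excluded_middle_informative _) as [H | H]; [contradiction | auto].
Qed.

Lemma pdf_val f i : function_on f w -> pdf (fun e => e 0 = val f (e (S i))).
Proof.
intros Hf.
apply dfn_iff with (R' := fun _ e =>
  app f (e (S i)) (e 0) \/ (~ exists z, app f (e (S i)) z) /\ e 0 = e (S i)).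
- intros _ e; apply val_graph, Hf.
- repeat dfn_step.
Qed.

Lemma pdf_sat_val phi (F : nat -> K) : (forall i, function_on (F i) w) ->
  def1 (fun n => sat (fun i => val (F i) n) phi).
Proof.
intros HF; apply (pdf_sat phi (t := fun i e => val (F i) (e 0))).
intros i; apply pdf_val, HF.
Qed.

Lemma pdf_sat_val_scons phi (F : nat -> K) : (forall i, function_on (F i) w) ->
  def2 (fun n y => sat (y .: fun i => val (F i) n) phi).
Proof.
intros HF.
set (t := fun i e => match i with 0 => e 1 | S i => val (F i) (e 0) end).
apply dfn_iff with (R' := fun _ e => sat (fun i => t i e) phi).
- intros _ e; match goal with |- sat ?a _ <-> sat ?b _ =>
    replace b with a; [reflexivity |] end.
  apply functional_extensionality; intros [|i]; reflexivity.
- apply pdf_sat; intros [|i]; [unfold t; dfn | apply pdf_val, HF].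
Qed.

(** Stated through a subset in [U], so that it makes sense for external [P]; for definable [P] the
    set of all [n ∈ w] satisfying [P] is then itself in [U], by [large_iff_exact]. *)
Definition large (P : K -> Prop) : Prop := exists s, s ∈ U /\ forall n, n ∈ s -> P n.

Lemma large_sub s n : s ∈ U -> n ∈ s -> n ∈ w.
Proof. intros Hs; apply HU; exact Hs. Qed.

Lemma large_mono (P Q : K -> Prop) :
  (forall n, n ∈ w -> P n -> Q n) -> large P -> large Q.
Proof.
intros H [s [Hs HP]]; exists s; split; auto.
intros n Hn; apply H; auto; apply large_sub with s; auto.
Qed.

Lemma large_all (P : K -> Prop) : (forall n, n ∈ w -> P n) -> large P.
Proof. intros H; exists w; split; [apply HU | exact H]. Qed.

Lemma large_and (P Q : K -> Prop) : large P -> large Q -> large (fun n => P n /\ Q n).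
Proof.
intros [s [Hs HP]] [t [Ht HQ]].
assert (D : def1 (fun n => n ∈ t)) by dfn.
destruct (separation HZ s D) as [r Hr]; exists r; split.
- destruct HU as [_ [_ [_ [_ [Hi _]]]]]; apply (Hi s t); auto.
- intros n Hn; apply Hr in Hn; destruct Hn; auto.
Qed.

Lemma large_not_empty (P : K -> Prop) : large P -> exists n, n ∈ w /\ P n.
Proof.
intros [s [Hs HP]]; apply NNPP; intros N.
destruct HU as [_ [_ [He _]]]; apply (He s); auto.
intros n Hn; apply N; exists n; split; auto; apply large_sub with s; auto.
Qed.

(** The ultrafilter dichotomy applies to sets of [K]; definability of [P] makes the two halves of
    [w] such sets. *)
Lemma large_not (P : K -> Prop) : def1 P -> large (fun n => ~ P n) <-> ~ large P.
Proof.
intros HP; split.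
- intros H H'; destruct (large_not_empty (large_and H H')) as [n [_ Hn]]; tauto.
- intros N.
  assert (HP' : def1 (fun n => ~ P n)) by dfn.
  destruct (separation HZ w HP) as [s Hs], (separation HZ w HP') as [t Ht].
  destruct HU as [_ [_ [_ [_ [_ [Hu _]]]]]].
  destruct (Hu s t) as [H | H].
  + intros n Hn; apply Hs, Hn.
  + intros n; rewrite Ht, Hs; tauto.
  + elim N; exists s; split; auto; intros n Hn; apply Hs, Hn.
  + exists t; split; auto; intros n Hn; apply Ht, Hn.
Qed.

Lemma large_iff_exact (P : K -> Prop) : def1 P ->
  large P <-> exists s, s ∈ U /\ forall n, n ∈ s <-> n ∈ w /\ P n.
Proof.
intros HP; split.
- intros [t [Ht HPt]]; destruct (separation HZ w HP) as [s Hs]; exists s; split; auto.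
  destruct HU as [_ [_ [_ [Hup _]]]]; apply (Hup t s); auto.
  + intros n Hn; apply Hs; split; auto; apply large_sub with t; auto.
  + intros n Hn; apply Hs, Hn.
- intros [s [Hs H]]; exists s; split; auto; intros n Hn; apply H, Hn.
Qed.

Lemma eq_mod_large f g : function_on f w -> function_on g w ->
  eq_mod w U f g <-> large (fun n => val f n = val g n).
Proof.
intros Hf Hg.
assert (D : def1 (fun n => exists y, app f n y /\ app g n y)) by dfn.
transitivity (large (fun n => exists y, app f n y /\ app g n y)).
- symmetry; apply large_iff_exact, D.
- split; apply large_mono; intros n Hn.
  + intros [y [Hy Hy']]; rewrite (val_eq Hf Hy), (val_eq Hg Hy'); auto.
  + intros E; exists (val f n); split; [| rewrite E]; apply val_app; auto.
Qed.

Lemma mem_mod_large f g : function_on f w -> function_on g w ->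
  mem_mod w U f g <-> large (fun n => val f n ∈ val g n).
Proof.
intros Hf Hg.
assert (D : def1 (fun n => exists y z, app f n y /\ app g n z /\ y ∈ z)) by dfn.
transitivity (large (fun n => exists y z, app f n y /\ app g n z /\ y ∈ z)).
- symmetry; apply large_iff_exact, D.
- split; apply large_mono; intros n Hn.
  + intros [y [z [Hy [Hz H]]]]; rewrite (val_eq Hf Hy), (val_eq Hg Hz); auto.
  + intros E; exists (val f n), (val g n); auto using val_app.
Qed.

(** * Representatives, Łoś's theorem and transfer *)

Let M := ultrapower w U.

Definition represents f (c : M) : Prop :=
  function_on f w /\ forall g, proj1_sig c g <-> class w U f g.

Lemma represents_exists (c : M) : exists f, represents f c.
Proof. destruct c as [c [f [Hf Hc]]]; exists f; split; auto. Qed.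

Lemma represented_exists f : function_on f w -> exists c, represents f c.
Proof.
intros Hf.
exists (exist _ (class w U f) (ex_intro _ f (conj Hf (fun g => iff_refl _)))).
split; auto; reflexivity.
Qed.

Lemma represents_self f c : represents f c -> proj1_sig c f.
Proof.
intros [Hf Hc]; apply Hc; split; auto; apply eq_mod_large; auto.
apply large_all; reflexivity.
Qed.

Lemma represents_eq f g c d : represents f c -> represents g d ->
  c = d <-> large (fun n => val f n = val g n).
Proof.
intros Hc Hd; pose proof (proj1 Hc) as Hf; pose proof (proj1 Hd) as Hg; split.
- intros ->; apply eq_mod_large; auto; apply Hc, represents_self, Hd.
- intros E; destruct c as [c pc], d as [d pd].
  assert (c = d) as ->.
  + apply functional_extensionality; intros h; apply propositional_extensionality.
    transitivity (class w U f h); [apply Hc |].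
    transitivity (class w U g h); [| symmetry; apply Hd].
    split; intros [Hh E']; split; auto; apply eq_mod_large in E'; auto;
      apply eq_mod_large; auto; generalize (large_and E E'); apply large_mono;
      intros n _ [E1 E2]; congruence.
  + f_equal; apply proof_irrelevance.
Qed.

Lemma represents_mem f g c d : represents f c -> represents g d ->
  c ∈ d <-> large (fun n => val f n ∈ val g n).
Proof.
intros Hc Hd; pose proof (proj1 Hc) as Hf; pose proof (proj1 Hd) as Hg; split.
- intros [f' [g' [Hf' [Hg' E]]]]; apply Hc in Hf'; apply Hd in Hg'.
  destruct Hf' as [Hf' Ef], Hg' as [Hg' Eg].
  apply eq_mod_large in Ef, Eg; auto; apply mem_mod_large in E; auto.
  generalize (large_and (large_and Ef Eg) E); apply large_mono.
  intros n _ [[-> ->] H]; exact H.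
- intros E; exists f, g; repeat split; try (apply represents_self; auto).
  apply mem_mod_large; auto.
Qed.

(** Collection bounds the possible values by a set [B]. The fibres of pairs [(n, y)] with [y ∈ B]
    and [R n y] are nonempty, and disjoint because a pair determines [n]; a transversal of them is
    the graph of a choice function. *)
Lemma choice_function (R : K -> K -> Prop) : def2 R ->
  (forall n, n ∈ w -> exists y, R n y) ->
  exists g, function_on g w /\ forall n, n ∈ w -> R n (val g n).
Proof.
intros HR Ht; destruct (collection HZ HR Ht) as [B HB].
assert (Hfib : forall n, exists A : K, forall p,
  p ∈ A <-> exists y, y ∈ B /\ R n y /\ is_opair p n y).
{ intros n.
  assert (D : def2 (fun y p => R n y /\ is_opair p n y)) by dfn.
  apply (replacement HZ D); intros y p q _ [_ Hp] [_ Hq]; exact (opair_unique HZ Hp Hq). }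
assert (D : def2 (fun n A => forall p,
  p ∈ A <-> exists y, y ∈ B /\ R n y /\ is_opair p n y)) by dfn.
destruct (replacement HZ D (a := w)) as [X HX].
{ intros n A A' _ H H'; apply (set_ext HZ); intros p; rewrite H, H'; reflexivity. }
destruct (proj2 HK X) as [c Hc].
{ intros A HA; apply HX in HA; destruct HA as [n [Hn HA]].
  destruct (HB n Hn) as [y [Hy Hny]], (opair_exists HZ n y) as [p Hp].
  exists p; apply HA; exists y; auto. }
{ intros A A' p HA HA' Hp Hp'; apply HX in HA, HA'.
  destruct HA as [n [_ HA]], HA' as [n' [_ HA']].
  assert (n = n') as <-.
  { apply HA in Hp; apply HA' in Hp'; destruct Hp as [y [_ [_ Hp]]], Hp' as [y' [_ [_ Hp']]].
    apply (opair_inj Hp Hp'). }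
  apply (set_ext HZ); intros q; rewrite HA, HA'; reflexivity. }
assert (D' : def2 (fun n y => y ∈ B /\ R n y /\ exists p, p ∈ c /\ is_opair p n y)) by dfn.
destruct (function_exists HZ D' (s := w)) as [g [Hg Happ]].
{ intros n Hn; destruct (Hfib n) as [A HA].
  destruct (Hc A) as [p [[Hp Hpc] Hu]]; [apply HX; exists n; auto |].
  pose proof Hp as Hp'; apply HA in Hp'; destruct Hp' as [y [Hy [Hny Hpy]]].
  exists y; split; [repeat split; auto; exists p; auto |].
  intros y' [Hy' [Hny' [p' [Hp' Hpy']]]].
  assert (p = p') as <-; [| apply (opair_inj Hpy Hpy')].
  apply Hu; split; auto; apply HA; exists y'; auto. }
exists g; split; auto.
intros n Hn; apply (Happ n (val g n)), val_app; auto.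
Qed.

Theorem Los phi (F : nat -> K) (c : nat -> M) : (forall i, represents (F i) (c i)) ->
  sat c phi <-> large (fun n => sat (fun i => val (F i) n) phi).
Proof.
revert F c; induction phi; intros F c Hc; cbn [sat]; try contradiction.
- apply represents_eq; apply Hc.
- apply represents_mem; apply Hc.
- rewrite (IHphi F c Hc), large_not; [reflexivity |].
  apply pdf_sat_val; intros i; apply Hc.
- rewrite (IHphi1 F c Hc), (IHphi2 F c Hc); split.
  + intros [H1 H2]; apply large_and; auto.
  + intros H; split; revert H; apply large_mono; tauto.
- assert (HF : forall i, function_on (F i) w) by (intros i; apply Hc).
  assert (IH : forall f a, represents f a ->
    sat (a .: c) phi <-> large (fun n => sat (val f n .: fun i => val (F i) n) phi)).
  { intros f a Ha; rewrite (IHphi (f .: F)) by (intros [|i]; [exact Ha | apply Hc]).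
    match goal with |- large ?a <-> large ?b => replace b with a; [reflexivity |] end.
    apply functional_extensionality; intros n.
    f_equal; apply functional_extensionality; intros [|i]; reflexivity. }
  split.
  + intros [a Ha]; destruct (represents_exists a) as [f Hf].
    apply (IH f a Hf) in Ha; revert Ha; apply large_mono; intros n _ H; eauto.
  + intros H; pose proof (pdf_sat_val_scons phi HF) as D.
    set (R := fun n y => sat (y .: fun i => val (F i) n) phi) in D.
    (* Witnesses may be missing outside the large set; the implication makes the relation total. *)
    assert (D' : def2 (fun n y => (exists z, R n z) -> R n y)) by dfn.
    destruct (choice_function D') as [g [Hg HgR]].
    { intros n _; destruct (classic (exists z, R n z)) as [[z Hz] | N];
        [exists z; auto | exists n; tauto]. }
    destruct (represented_exists Hg) as [a Ha]; exists a; apply (IH g a Ha).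
    revert H; apply large_mono; exact HgR.
Qed.

Let j : K -> M := const_embedding HZ w U.

Lemma constant_represents k c : constant_function w k c -> represents c (j k).
Proof.
intros Hc; split; [apply Hc |]; intros g; cbn; unfold constant_class; split.
- intros [d [Hd Hg]]; rewrite (constant_function_unique HZ Hc Hd); exact Hg.
- intros Hg; exists c; auto.
Qed.

Lemma constant_val k c n : constant_function w k c -> n ∈ w -> val c n = k.
Proof. intros [Hc Hk] Hn; apply val_eq; auto. Qed.

Lemma constants (e : nat -> K) : exists F, forall i, constant_function w (e i) (F i).
Proof.
apply (choice (fun i c => constant_function w (e i) c)); intros i.
apply (constant_function_exists HZ).
Qed.

Theorem const_embedding_elementary : elementary_embedding j.
Proof.
intros phi e; destruct (constants e) as [F HF].
rewrite (Los phi (fun i => constant_represents (HF i))).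
assert (H : forall n, n ∈ w -> (fun i => val (F i) n) = e).
{ intros n Hn; apply functional_extensionality; intros i; apply constant_val; auto. }
split.
- intros He; apply large_all; intros n Hn; rewrite (H n Hn); exact He.
- intros HL; apply large_not_empty in HL; destruct HL as [n [Hn He]].
  rewrite (H n Hn) in He; exact He.
Qed.

Lemma udf_elementary R (e : nat -> K) : udf R -> R K e <-> R M (fun i => j (e i)).
Proof.
intros [phi [v Hv]]; rewrite !Hv; etransitivity; [apply const_embedding_elementary |].
match goal with |- sat ?a _ <-> sat ?b _ => replace b with a; [reflexivity |] end.
apply functional_extensionality; intros n; unfold lookup; destruct (v n) as [|[]]; reflexivity.
Qed.

(** Representatives of the assignment have their values in [K], where [R] holds at every coordinate.
    In contrast to elementarity of [j], this reaches parameters outside the range of [j]. *)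
Lemma udf_valid R : udf R -> (forall e, R K e) -> forall e, R M e.
Proof.
intros [phi [v Hv]] HR e; apply Hv.
destruct (choice (fun i f => represents f (e i)) (fun i => represents_exists (e i)))
  as [F HF].
set (G := lookup (F := fun S : set_structure => S) (fun S (c : Empty_set) =>
  match c return S with end) v (i := K) F).
apply (Los phi (F := G)).
- intros i; unfold G, lookup; destruct (v i) as [k | []]; apply HF.
- apply large_all; intros n _.
  replace (fun i => val (G i) n) with (lookup (F := fun S : set_structure => S)
    (fun S (c : Empty_set) => match c return S with end) v (i := K) (fun i => val (F i) n)).
  + apply Hv, HR.
  + apply functional_extensionality; intros i.
    unfold G, lookup; destruct (v i) as [k | []]; reflexivity.
Qed.

(** Parameters from the ultrapower are replaced by representatives in [K], and the constant function
    for [k] has value [k] at each coordinate, so [D (j k)] becomes a condition on [k] with [U] and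
    the representatives as parameters. *)
Lemma definable_trace (D : M -> Prop) : definable D -> def1 (fun k => D (j k)).
Proof.
intros [phi [e He]].
destruct (choice (fun i f => represents f (e i)) (fun i => represents_exists (e i)))
  as [F HF].
assert (D2 : def2 (fun n k => sat (k .: fun i => val (F i) n) phi))
  by (apply pdf_sat_val_scons; intros i; apply HF).
set (R := fun n k => sat (k .: fun i => val (F i) n) phi) in D2.
apply dfn_iff with (R' := fun _ r => exists s, s ∈ U /\ forall n, n ∈ s -> R n (r 0));
  [| repeat dfn_step].
intros _ r; rewrite He.
destruct (constant_function_exists HZ w (r 0)) as [c Hc].
rewrite (Los phi (F := c .: F)).
- split; apply large_mono; intros n Hn; unfold R;
  replace (r 0 .: fun i => val (F i) n) with (fun i => val ((c .: F) i) n); auto;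
  apply functional_extensionality; intros [|i]; cbn; auto using constant_val.
- intros [|i]; [apply constant_represents, Hc | apply HF].
Qed.

End Ultrapower.

(** * The axioms of ZF in the ultrapower *)

Lemma udf_sat_var (phi : form Empty_set Empty_set) (rho : nat -> nat)
    (E : forall S : set_structure, (nat -> S) -> nat -> S) :
  (forall (S : set_structure) (e : nat -> S) n, E S e n = e (rho n)) ->
  udf (fun S e => sat (E S e) phi).
Proof.
intros H; exists phi, (fun n => inl (rho n)); intros S e.
replace (E S e) with (fun n => e (rho n)); [reflexivity |].
apply functional_extensionality; intros n; symmetry; apply H.
Qed.

Lemma ZF_ultrapower (K : set_structure) (HK : ZFC K) (w U : K) :
  nonprincipal_ultrafilter U w -> ZF (ultrapower w U).
Proof.
intros HU; pose proof (proj1 HK) as HZ; split.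
- intros a b.
  apply (udf_valid HK HU (R := fun S e => (forall x, x ∈ e 0 <-> x ∈ e 1) -> e 0 = e 1))
    with (e := a .: fun _ => b); [dfn |].
  intros e; apply (ZF_extensionality HZ).
- intros a.
  apply (udf_valid HK HU (R := fun S e => (exists x, x ∈ e 0) ->
    exists x, x ∈ e 0 /\ forall y, y ∈ x -> ~ y ∈ e 0)) with (e := fun _ => a); [dfn |].
  intros e; apply (ZF_foundation HZ).
- intros a b.
  apply (udf_valid HK HU (R := fun S e => exists p, is_upair p (e 0) (e 1)))
    with (e := a .: fun _ => b); [dfn |].
  intros e; apply (ZF_pairing HZ).
- intros a.
  apply (udf_valid HK HU (R := fun S e => exists u, forall x,
    x ∈ u <-> exists y, y ∈ e 0 /\ x ∈ y)) with (e := fun _ => a); [dfn |].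
  intros e; apply (ZF_union HZ).
- intros a.
  apply (udf_valid HK HU (R := fun S e => exists p, is_power p (e 0)))
    with (e := fun _ => a); [dfn |].
  intros e; apply (ZF_power HZ).
(* Infinity has no free variables, but transfer needs an assignment; any element of the ultrapower
   provides one. *)
- destruct (constant_function_exists HZ w w) as [c Hc].
  destruct (represented_exists U (proj1 Hc)) as [a _].
  refine (udf_valid HK HU (R := fun S e => exists v : S, inductive v) _
    (fun _ => ZF_infinity HZ) (fun _ => a)); dfn.
- intros phi e a.
  apply (udf_valid HK HU (R := fun S e => exists b, forall x,
    x ∈ b <-> x ∈ e 0 /\ sat (x .: fun n => e (Datatypes.S n)) phi)) with (e := a .: e).
  + unfold udf; repeat dfn_step.
    (* Slot 0 is [x], slot 1 is [b], slot 2 is the set [a], and the parameters of [phi] start at 3.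
       In the other schemes the offset is likewise the number of binders plus one. *)
    apply udf_sat_var with (rho := 0 .: fun n => 3 + n).
    intros S e' [|n]; reflexivity.
  + intros e'; apply (ZF_separation HZ).
- intros phi e a.
  apply (udf_valid HK HU (R := fun S e =>
    (forall x y z, x ∈ e 0 -> sat (x .: y .: fun n => e (Datatypes.S n)) phi ->
      sat (x .: z .: fun n => e (Datatypes.S n)) phi -> y = z) ->
    exists b, forall y, y ∈ b <->
      exists x, x ∈ e 0 /\ sat (x .: y .: fun n => e (Datatypes.S n)) phi))
    with (e := a .: e).
  + unfold udf; repeat dfn_step.
    * apply udf_sat_var with (rho := 2 .: 1 .: fun n => 4 + n).
      intros S e' [|[|n]]; reflexivity.
    * apply udf_sat_var with (rho := 2 .: 0 .: fun n => 4 + n).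
      intros S e' [|[|n]]; reflexivity.
    * apply udf_sat_var with (rho := 0 .: 1 .: fun n => 4 + n).
      intros S e' [|[|n]]; reflexivity.
  + intros e'; apply (ZF_replacement HZ).
- intros phi e a.
  apply (udf_valid HK HU (R := fun S e =>
    (forall x, x ∈ e 0 -> exists y, sat (x .: y .: fun n => e (Datatypes.S n)) phi) ->
    exists b, forall x, x ∈ e 0 ->
      exists y, y ∈ b /\ sat (x .: y .: fun n => e (Datatypes.S n)) phi))
    with (e := a .: e).
  + unfold udf; repeat dfn_step.
    * apply udf_sat_var with (rho := 1 .: 0 .: fun n => 3 + n).
      intros S e' [|[|n]]; reflexivity.
    * apply udf_sat_var with (rho := 1 .: 0 .: fun n => 4 + n).
      intros S e' [|[|n]]; reflexivity.
  + intros e'; apply (ZF_collection HZ).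
Qed.

(** * Embeddings with transitive range *)

Section TransitiveEmbedding.
Context {A B : set_structure} (h : A -> B) (Hh : embedding h)
  (Ht : forall x y, y ∈ h x -> exists x', y = h x').

Lemma embedding_empty z : is_empty z <-> is_empty (h z).
Proof.
split; intros Hz x Hx.
- destruct (Ht Hx) as [y ->]; apply (Hz y), Hh, Hx.
- apply (Hz (h x)), Hh, Hx.
Qed.

Lemma embedding_succ s x : is_succ s x <-> is_succ (h s) (h x).
Proof.
split; intros Hs y.
- split.
  + intros Hy; destruct (Ht Hy) as [y' ->]; apply Hh, Hs in Hy.
    destruct Hy as [Hy | ->]; [left; apply Hh, Hy | auto].
  + intros [Hy | ->]; [| apply Hh, Hs; auto].
    destruct (Ht Hy) as [y' ->]; apply Hh, Hs; left; apply Hh, Hy.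
- split.
  + intros Hy; apply (proj2 Hh), Hs in Hy; destruct Hy as [Hy | Hy].
    * left; apply Hh, Hy.
    * right; apply Hh, Hy.
  + intros [Hy | ->]; apply (proj2 Hh), Hs; [left; apply Hh, Hy | auto].
Qed.

Lemma embedding_omega_like v : omega_like v <-> omega_like (h v).
Proof.
split.
- intros [[[z [Hz Hzv]] Hs] Hn]; split; [split |].
  + exists (h z); split; [apply embedding_empty, Hz | apply Hh, Hzv].
  + intros x Hx; destruct (Ht Hx) as [x' ->]; apply Hh in Hx.
    destruct (Hs x' Hx) as [s [Hsx Hsv]]; exists (h s).
    split; [apply embedding_succ, Hsx | apply Hh, Hsv].
  + intros x Hx; destruct (Ht Hx) as [x' ->]; apply Hh in Hx.
    destruct (Hn x' Hx) as [H | [y [Hy Hyx]]]; [left; apply embedding_empty, H |].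
    right; exists (h y); split; [apply Hh, Hy | apply embedding_succ, Hyx].
- intros [[[z [Hz Hzv]] Hs] Hn]; split; [split |].
  + destruct (Ht Hzv) as [z' ->]; exists z'; split.
    * apply embedding_empty, Hz.
    * apply Hh, Hzv.
  + intros x Hx; apply Hh in Hx; destruct (Hs _ Hx) as [s [Hsx Hsv]].
    destruct (Ht Hsv) as [s' ->]; exists s'.
    split; [apply embedding_succ, Hsx | apply Hh, Hsv].
  + intros x Hx; apply Hh in Hx; destruct (Hn _ Hx) as [H | [y [Hy Hyx]]].
    * left; apply embedding_empty, H.
    * destruct (Ht Hy) as [y' ->]; right; exists y'.
      split; [apply Hh, Hy | apply embedding_succ, Hyx].
Qed.

End TransitiveEmbedding.

(** Since omega is transitive, [num n] consists exactly of the [num m] with [m < n]; the order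
    isomorphism therefore respects zero and successor. *)
Lemma omega_standard_enumeration (K : set_structure) (HK : ZF K) (w : K) :
  omega_standard K -> is_omega w -> exists num : nat -> K,
    (forall x, x ∈ w <-> exists n, x = num n) /\
    is_empty (num 0) /\ forall n, is_succ (num (S n)) (num n).
Proof.
intros [w' [Hw' [num [Hinj [Hnum Hlt]]]]] Hw.
rewrite (omega_like_unique HK (omega_is_omega_like HK Hw') Hw) in Hnum.
exists num; split; [exact Hnum |].
assert (Helt : forall x n, x ∈ num n -> exists m, x = num m /\ m < n).
{ intros x n Hx.
  assert (Hxw : x ∈ w).
  { apply (omega_transitive HK Hw (y := num n)); [apply Hnum; exists n |]; auto. }
  apply Hnum in Hxw; destruct Hxw as [m ->]; exists m; split; auto; apply Hlt, Hx. }
split.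
- intros x Hx; destruct (Helt x 0 Hx) as [m [_ Hm]]; lia.
- intros n x; split.
  + intros Hx; destruct (Helt x _ Hx) as [m [-> Hm]].
    destruct (Nat.eq_dec m n) as [-> | N]; [auto | left; apply Hlt; lia].
  + intros [Hx | ->]; [| apply Hlt; lia].
    destruct (Helt x n Hx) as [m [-> Hm]]; apply Hlt; lia.
Qed.

(** * Nonstandard integers of the ultrapower *)

Section Nonstandard.
Context {K : set_structure} (HK : ZFC K) (Hstd : omega_standard K) (w U : K)
  (Hw : is_omega w) (HU : nonprincipal_ultrafilter U w).
Let HZ : ZF K := proj1 HK.
Let M := ultrapower w U.
Let HM : ZF M := ZF_ultrapower HK HU.
Let j : K -> M := const_embedding HZ w U.

(** If the class of the identity were [j k], then [n = k] would hold on a set in [U], and [U] would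
    be principal at [k]. *)
Lemma nonstandard_integer_exists : exists c : M, c ∈ j w /\ forall k, c <> j k.
Proof.
assert (D : def2 (fun n y : K => y = n)) by dfn.
destruct (function_exists HZ D (s := w)) as [f [Hf Happ]].
{ intros n _; exists n; split; auto. }
assert (Hval : forall n, n ∈ w -> val f n = n)
  by (intros n Hn; apply (val_eq Hf), Happ; auto).
destruct (represented_exists U Hf) as [c Hc]; exists c; split.
- destruct (constant_function_exists HZ w w) as [cw Hcw].
  apply (represents_mem HK HU Hc (constant_represents HK U Hcw)).
  apply (large_all HU); intros n Hn; rewrite (Hval n Hn), (constant_val Hcw Hn); exact Hn.
- intros k E; destruct (constant_function_exists HZ w k) as [ck Hck].
  apply (represents_eq HK HU Hc (constant_represents HK U Hck)) in E.
  apply (large_mono HU (Q := fun n => n = k)) in E.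
  2: { intros n Hn; rewrite (Hval n Hn), (constant_val Hck Hn); auto. }
  destruct (large_not_empty HU E) as [n [Hn Enk]]; subst n.
  destruct E as [s [Hs Hsk]].
  assert (Hks : forall x, x ∈ U -> k ∈ x).
  { intros x Hx; destruct (large_not_empty HU (P := fun n => n ∈ x /\ n = k))
      as [n [_ [Hnx <-]]]; [| exact Hnx].
    apply (large_and HK HU); [exists x | exists s]; auto. }
  pose proof HU as [HUw [_ [_ [Hup [_ [_ Hnp]]]]]].
  apply Hnp; exists k; split; [exact Hn |]; intros x; split.
  + intros Hx; split; auto.
  + intros [Hxw Hkx]; apply (Hup s x); auto.
    intros n Hns; rewrite (Hsk n Hns); exact Hkx.
Qed.

Lemma const_embedding_empty z : is_empty z -> is_empty (j z).
Proof.
apply (udf_elementary HK HU (R := fun S e => is_empty (e 0)) (fun _ => z)); dfn.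
Qed.

Lemma const_embedding_succ s x : is_succ s x -> is_succ (j s) (j x).
Proof.
apply (udf_elementary HK HU (R := fun S e => is_succ (e 0) (e 1)) (s .: fun _ => x)); dfn.
Qed.

Lemma const_embedding_omega : is_omega (j w).
Proof.
apply (udf_elementary HK HU (R := fun S e => is_omega (e 0)) (fun _ => w)); [dfn |].
exact Hw.
Qed.

(** The preimage of [j w] is omega-like, hence [w]. A nonstandard integer [c ∈ h w] would be [h y]
    with [y] some [num n], so [c = j (num n)]. *)
Lemma no_transitive_embedding_into_ultrapower (h : K -> M) : embedding h ->
  (forall x y, y ∈ h x -> exists x', y = h x') -> ~ exists x, j w = h x.
Proof.
intros Hh Ht [x Hx].
destruct (omega_standard_enumeration HZ Hstd Hw) as [num [Hnum [H0 HS]]].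
assert (x = w) as ->.
{ apply (omega_like_unique HZ); [| exact Hw].
  apply (embedding_omega_like Hh Ht); rewrite <- Hx.
  apply (omega_is_omega_like HM const_embedding_omega). }
assert (E : forall n, h (num n) = j (num n)).
{ induction n as [|n IH].
  - apply (empty_unique HM); [apply (embedding_empty Hh Ht) | apply const_embedding_empty];
      exact H0.
  - apply (succ_unique HM (x := j (num n))); [| apply const_embedding_succ, HS].
    rewrite <- IH; apply (embedding_succ Hh Ht), HS. }
destruct nonstandard_integer_exists as [c [Hc Nc]].
rewrite Hx in Hc; destruct (Ht _ _ Hc) as [y ->]; apply Hh, Hnum in Hc.
destruct Hc as [n ->]; exact (Nc _ (E n)).
Qed.

(** Here [h (j w) = w], so [h c] is some [num n = h (j (num n))], and injectivity makes [c]
    standard. *)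
Lemma no_transitive_embedding_of_ultrapower (h : M -> K) : embedding h ->
  ~ forall x y, y ∈ h x -> exists x', y = h x'.
Proof.
intros Hh Ht.
destruct (omega_standard_enumeration HZ Hstd Hw) as [num [Hnum [H0 HS]]].
assert (Hjw : h (j w) = w).
{ apply (omega_like_unique HZ); [| exact Hw].
  apply (embedding_omega_like Hh Ht), (omega_is_omega_like HM const_embedding_omega). }
assert (E : forall n, h (j (num n)) = num n).
{ induction n as [|n IH].
  - apply (empty_unique HZ); [| exact H0].
    apply (embedding_empty Hh Ht), const_embedding_empty, H0.
  - apply (succ_unique HZ (x := num n)); [| apply HS].
    rewrite <- IH; apply (embedding_succ Hh Ht), const_embedding_succ, HS. }
destruct nonstandard_integer_exists as [c [Hc Nc]].
apply Hh in Hc; rewrite Hjw in Hc; apply Hnum in Hc; destruct Hc as [n Hn].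
apply (Nc (num n)), Hh; rewrite Hn, E; reflexivity.
Qed.

End Nonstandard.

Theorem mainTheorem5 (K : set_structure) (HK : ZFC K) (Hstd : omega_standard K)
    (w U : K) (Hw : is_omega w) (HU : nonprincipal_ultrafilter U w) :
  let M := ultrapower w U in
  let j := const_embedding (proj1 HK) w U in
  elementary_embedding j /\
  (ZF M /\ ZF K /\
   forall D : M -> Prop, definable D -> ZF (expand (fun k => D (j k)))) /\
  ~ iso_with_V_inaccessible j /\
  ~ iso_with_M j /\
  ~ embeds_as_proper_rank_initial_segment j.
Proof.
intros M j; pose proof (proj1 HK) as HZ; pose proof (ZF_ultrapower HK HU) as HM.
split; [exact (const_embedding_elementary HK HU) |].
split; [split; [exact HM | split; [exact HZ |]] | split; [| split]].
- intros D HD; apply ZF_expand; [exact (definable_trace HK HU HD) | exact HZ].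
- intros [kappa [v [Hkappa [Hv [h [Hh [Hrange _]]]]]]].
  destruct Hkappa as [[Ok _] [[w' [Hw' Hwk]] _]].
  apply (no_transitive_embedding_into_ultrapower Hstd Hw HU (HK := HK) Hh).
  + intros x y Hy; apply Hrange; apply (V_transitive HM Ok Hv (y := h x)); auto.
    apply Hrange; exists x; auto.
  (* Omega belongs to the range because [ω ∈ κ ⊆ V_κ]. *)
  + apply Hrange, (ordinal_sub_V HM Ok Hv).
    rewrite <- (omega_like_unique HM (omega_is_omega_like HM Hw')
      (const_embedding_omega HK Hw HU)); exact Hwk.
- intros [h [Hh [Hrange _]]].
  apply (no_transitive_embedding_into_ultrapower Hstd Hw HU (HK := HK) Hh); auto.
- intros [h [Hh [_ [Hinit _]]]].
  apply (no_transitive_embedding_of_ultrapower HK Hstd Hw HU Hh).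
  intros x y Hy; apply (Hinit (h x)); [exists x; reflexivity |].
  apply (mem_rank_le HZ), Hy.
Qed.
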